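(* Consider $\mathrm{SL}_3(\mathbb{C})$ as a spherical homogeneous space under $\mathrm{SL}_3(\mathbb{C})\times\mathrm{SL}_3(\mathbb{C})$ acting by $(g,h)\cdot k=gkh^{-1}$, with spherical functions $$\phi_i(x)=\frac{1}{\binom{3}{i}}\sum_{|J|=|L|=i}|p_{J,L}(x)|^2,\qquad i=1,2,$$ where $p_{J,L}(x)$ is the minor of $x$ with rows $J$ and columns $L$, and let $\mathrm{sLog}_{\Gamma,t}=(\log_t\phi_1,\log_t\phi_2):\mathrm{SL}_3(\mathbb{C})\to\mathbb{R}^2$ for $0<t<1$. Then $\mathrm{sLog}_{\Gamma,t}(\mathrm{SL}_3(\mathbb{C}))$ is the region bounded by the two curves $$\Big\{\Big(\log_t\tfrac{2x^3+1}{3x^2},\ \log_t\tfrac{2+x^3}{3x}\Big):x\in[1,\infty)\Big\}\quad\text{and}\quad\Big\{\Big(\log_t\tfrac{2+x^3}{3x},\ \log_t\tfrac{2x^3+1}{3x^2}\Big):x\in[1,\infty)\Big\},$$ and as $t\to0$ the sets $\mathrm{sLog}_{\Gamma,t}(\mathrm{SL}_3(\mathbb{C}))$ converge in the sense of Kuratowski to the (real) valuation cone, i.e. the antidominant Weyl chamber, which in these coordinates is $\{(a_1,a_2)\in\mathbb{R}^2: 2a_1-a_2\leq0,\ 2a_2-a_1\leq0\}$.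
   Context: $\log_t(y)=\ln y/\ln t$. The map $\mathrm{sLog}_{\Gamma,t}$ is the spherical logarithm for $\Gamma=\{(\omega_i,-\omega_i):i=1,2\}$, where $\omega_i$ are the fundamental weights of $\mathrm{SL}_3(\mathbb{C})$. The valuation cone, i.e. the set of $(\mathrm{SL}_3(\mathbb{C})\times\mathrm{SL}_3(\mathbb{C}))$-invariant discrete $\mathbb{Q}$-valued valuations of the function field of $\mathrm{SL}_3(\mathbb{C})$ trivial on $\mathbb{C}^*$, is identified with the antidominant Weyl chamber $\{\xi:\langle\xi,\alpha\rangle\leq0\text{ for all positive roots }\alpha\}$ of rational coweights; a coweight $\xi$ has coordinates $(a_1,a_2)=(\langle\xi,\omega_1\rangle,\langle\xi,\omega_2\rangle)$, and the real valuation cone is the Euclidean closure in $\mathbb{R}^2$. Kuratowski convergence of $X_t\subset\mathbb{R}^2$ to $X_0\subset\mathbb{R}^2$ as $t\to0^+$: (a) every $y\notin X_0$ has a neighbourhood $U$ and $\varepsilon>0$ with $X_t\cap U=\emptyset$ for $0<t<\varepsilon$; (b) for every $y\in X_0$ and every neighbourhood $U$ of $y$ there is $\varepsilon>0$ with $X_t\cap U\neq\emptyset$ for $0<t<\varepsilon$. *)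

(* Defs.v *)
From HB Require Import structures.
From mathcomp Require Import all_boot all_order all_algebra fraction.
From mathcomp Require Import complex.
From mathcomp Require Import all_classical all_reals all_analysis.

Set Implicit Arguments.
Unset Strict Implicit.
Unset Printing Implicit Defensive.

Import Order.TTheory GRing.Theory Num.Theory.
Import numFieldNormedType.Exports.

Local Open Scope classical_set_scope.
Local Open Scope ring_scope.
Local Open Scope complex_scope.

Record SL3 (R : realType) := MkSL3 {
  SL3_mx :> 'M[R[i]]_3;
  SL3_det : \det SL3_mx == 1 }.

HB.instance Definition _ (R : realType) := [isSub for @SL3_mx R].
HB.instance Definition _ (R : realType) := [Choice of SL3 R by <:].

Lemma SL3_one_proof (R : realType) : \det (1%:M : 'M[R[i]]_3) == 1.
Proof. by rewrite det1. Qed.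

HB.instance Definition _ (R : realType) :=
  isPointed.Build (SL3 R) (MkSL3 (SL3_one_proof R)).

Lemma SL3_act_proof (R : realType) (g h k : SL3 R) :
  \det (g *m k *m invmx h) == 1.
Proof.
by rewrite !det_mulmx det_inv (eqP (SL3_det g)) (eqP (SL3_det h))
           (eqP (SL3_det k)) invr1 !mulr1.
Qed.

Definition SL3_act (R : realType) (g h k : SL3 R) : SL3 R :=
  MkSL3 (SL3_act_proof g h k).

Lemma SL3_inv_proof (R : realType) (g : SL3 R) : \det (invmx g) == 1.
Proof. by rewrite det_inv (eqP (SL3_det g)) invr1. Qed.

Definition SL3_inv (R : realType) (g : SL3 R) : SL3 R :=
  MkSL3 (SL3_inv_proof g).

(* p_{J,L} (rows J, columns L): [enum J] lists J in increasing order, and the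
   value is only meaningful when J and L both have i elements. *)
Definition minor (K : comNzRingType) (i : nat) (J L : {set 'I_3})
    (x : 'M[K]_3) : K :=
  \det (\matrix_(a < i, b < i) x (nth ord0 (enum J) a) (nth ord0 (enum L) b)).

Inductive regular (R : realType) : (SL3 R -> R[i]) -> Prop :=
| regular_cst c : regular (fun=> c)
| regular_entry j k : regular (fun x => x j k)
| regular_add f g : regular f -> regular g -> regular (fun x => f x + g x)
| regular_mul f g : regular f -> regular g -> regular (fun x => f x * g x).

Definition regular_pred (R : realType) : {pred (SL3 R -> R[i])} :=
  fun f => `[< regular f >].

Lemma regular_subring (R : realType) : subring_closed (@regular_pred R).
Proof.
split; first by apply/asboolP; exact: regular_cst.
- move=> f g /asboolP rf /asboolP rg; apply/asboolP.
  have -> : f - g = (fun x => f x + (-1) * g x).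
    by apply/funext => x; rewrite mulN1r.
  exact: (regular_add rf (regular_mul (regular_cst (-1)) rg)).
- move=> f g /asboolP rf /asboolP rg; apply/asboolP.
  exact: (regular_mul rf rg).
Qed.

HB.instance Definition _ (R : realType) :=
  GRing.isSubringClosed.Build (SL3 R -> R[i]) (@regular_pred R)
    (@regular_subring R).

Record CSL3 (R : realType) := MkCSL3 {
  CSL3_fun :> SL3 R -> R[i];
  CSL3_regular : CSL3_fun \in @regular_pred R }.

HB.instance Definition _ (R : realType) := [isSub for @CSL3_fun R].
HB.instance Definition _ (R : realType) := [Choice of CSL3 R by <:].
HB.instance Definition _ (R : realType) :=
  [SubChoice_isSubComNzRing of CSL3 R by <:].

Definition CSL3_unit (R : realType) : pred (CSL3 R) :=
  fun f => `[< exists g, g * f = 1 >].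

Definition CSL3_inverse (R : realType) (f : CSL3 R) : CSL3 R :=
  if pselect (exists g, g * f = 1) is left H then sval (cid H) else f.

Lemma CSL3_mulVf (R : realType) :
  {in @CSL3_unit R, left_inverse 1 (@CSL3_inverse R) *%R}.
Proof.
move=> f /asboolP Uf; rewrite /CSL3_inverse.
by case: pselect => // H; case: (cid H).
Qed.

Lemma CSL3_unitPl (R : realType) (f g : CSL3 R) : g * f = 1 -> @CSL3_unit R f.
Proof. by move=> gf; apply/asboolP; exists g. Qed.

Lemma CSL3_invr_out (R : realType) :
  {in [predC @CSL3_unit R], @CSL3_inverse R =1 id}.
Proof.
move=> f /negP Uf; rewrite /CSL3_inverse; case: pselect => // H.
by case: Uf; apply/asboolP.
Qed.

HB.instance Definition _ (R : realType) :=
  GRing.ComNzRing_hasMulInverse.Build (CSL3 R)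
    (@CSL3_mulVf R) (@CSL3_unitPl R) (@CSL3_invr_out R).

(* SL_3 is irreducible: along the line A + s (B - A), rescaled into SL_3 by
   dividing the first row by the determinant d(s), a regular function becomes a
   rational function of s whose denominator is a power of d. *)
Section Irreducible.
Variables (R : realType) (A B : SL3 R).

Let P : 'M[{poly R[i]}]_3 :=
  \matrix_(j, k) ((A j k)%:P + 'X * (B j k - A j k)%:P).
Let d : {poly R[i]} := \det P.
Let Ps s : 'M[R[i]]_3 := map_mx (horner_eval s) P.
Let Q s : 'M[R[i]]_3 :=
  \matrix_(j, k) ((if j == 0 then (d.[s])^-1 else 1) * Ps s j k).

Local Lemma det_Ps s : \det (Ps s) = d.[s].
Proof. by rewrite det_map_mx. Qed.

Local Lemma det_Q s : d.[s] != 0 -> \det (Q s) == 1.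
Proof.
move=> ds; have -> : Q s =
    diag_mx (\row_j (if j == 0 then (d.[s])^-1 else 1)) *m Ps s.
  by apply/matrixP => j k; rewrite mul_diag_mx !mxE.
rewrite det_mulmx det_Ps det_diag big_ord_recl mxE eqxx big1 ?mulr1 ?mulVf //.
by move=> j _; rewrite mxE.
Qed.

Local Lemma Ps0 : Ps 0 = A.
Proof.
by apply/matrixP => j k; rewrite !mxE /horner_eval !hornerE.
Qed.

Local Lemma Ps1 : Ps 1 = B.
Proof.
apply/matrixP => j k; rewrite !mxE /horner_eval hornerD hornerM hornerX !hornerC.
by rewrite mul1r addrC subrK.
Qed.

Local Lemma d0 : d.[0] = 1.
Proof. by rewrite -det_Ps Ps0 (eqP (SL3_det A)). Qed.

Local Lemma d1 : d.[1] = 1.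
Proof. by rewrite -det_Ps Ps1 (eqP (SL3_det B)). Qed.

Local Lemma Q_Ps s : d.[s] = 1 -> Q s = Ps s.
Proof.
by move=> ds; apply/matrixP => j k; rewrite mxE ds invr1 if_same mul1r.
Qed.

Local Lemma regular_line (f : SL3 R -> R[i]) : regular f ->
  exists N (p : {poly R[i]}), forall s (x : SL3 R), d.[s] != 0 ->
    SL3_mx x = Q s -> f x * d.[s] ^+ N = p.[s].
Proof.
elim=> [c|j k|g h _ [N [p Hp]] _ [M [q Hq]]|g h _ [N [p Hp]] _ [M [q Hq]]].
- by exists 0%N, c%:P => s x _ _; rewrite mulr1 hornerC.
- exists 1%N, ((if j == 0 then 1 else d) * P j k) => s x ds ->.
  rewrite !mxE /horner_eval !hornerM expr1; case: ifP => _.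
    by rewrite hornerC mul1r mulrAC mulVf // mul1r.
  by rewrite mul1r mulrC.
- exists (N + M)%N, (p * d ^+ M + q * d ^+ N) => s x ds xQ.
  rewrite mulrDl hornerD !hornerM !horner_exp -(Hp s x) // -(Hq s x) //.
  by rewrite exprD !mulrA; congr (_ + _); rewrite mulrAC.
- exists (N + M)%N, (p * q) => s x ds xQ.
  by rewrite hornerM -(Hp s x) // -(Hq s x) // exprD mulrACA.
Qed.

Local Lemma regular_mul_neq0 (f g : SL3 R -> R[i]) : regular f -> regular g ->
  f A != 0 -> g B != 0 -> exists x, f x * g x != 0.
Proof.
move=> /regular_line[N [p Hp]] /regular_line[M [q Hq]] fA gB.
have p0 : p != 0.
  apply: contraNneq fA => p0; apply/eqP.
  have := Hp 0 A; rewrite Q_Ps ?d0 // Ps0 oner_neq0 => /(_ isT erefl).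
  by rewrite expr1n mulr1 p0 horner0.
have q0 : q != 0.
  apply: contraNneq gB => q0; apply/eqP.
  have := Hq 1 B; rewrite Q_Ps ?d1 // Ps1 oner_neq0 => /(_ isT erefl).
  by rewrite expr1n mulr1 q0 horner0.
have dn0 : d != 0.
  by apply: contra_eq_neq d0 => ->; rewrite horner0 eq_sym oner_neq0.
have pqd : p * q * d != 0 by rewrite !mulf_neq0.
have [s] : exists s, ~~ root (p * q * d) s.
  pose r := [seq (i%:R : R[i]) | i <- iota 0 (size (p * q * d))].
  have ur : uniq r.
    rewrite map_inj_uniq ?iota_uniq // => a b /eqP.
    by rewrite eqr_nat => /eqP.
  have [/(max_poly_roots pqd)/(_ ur)|/allPn[s _ ?]] := boolP (all (root (p * q * d)) r).
    by rewrite size_map size_iota ltnn.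
  by exists s.
rewrite /root !hornerM !mulf_eq0 !negb_or => /andP[/andP[ps qs] ds].
pose y := MkSL3 (det_Q ds); exists y; rewrite mulf_neq0 //.
- by apply: contraNneq ps => fx; rewrite -(Hp s y ds erefl) fx mul0r.
- by apply: contraNneq qs => gx; rewrite -(Hq s y ds erefl) gx mul0r.
Qed.

End Irreducible.

Lemma CSL3_integral (R : realType) : GRing.integral_domain_axiom (CSL3 R).
Proof.
have nz (f : CSL3 R) : f != 0 -> exists A, f A != 0.
  move=> f0; apply: contrapT => /forallNP H; move/eqP: f0; apply.
  by apply/val_inj/funext => A; have /negP/negPn/eqP := H A.
move=> f g fg; apply/norP => -[/nz[A fA] /nz[B gB]].
have [x] := regular_mul_neq0 (asboolW (CSL3_regular f))
  (asboolW (CSL3_regular g)) fA gB.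
by rewrite -[f x * g x]/((f * g) x) fg => /eqP.
Qed.

HB.instance Definition _ (R : realType) :=
  GRing.ComUnitRing_isIntegral.Build (CSL3 R) (@CSL3_integral R).

Notation function_field R := {fraction (CSL3 R)}.

Lemma regular_sum (R : realType) (I : Type) (r : seq I) (P : pred I)
    (F : I -> SL3 R -> R[i]) :
  (forall j, regular (F j)) -> regular (fun x => \sum_(j <- r | P j) F j x).
Proof.
move=> rF; elim: r => [|j r IHr].
  by under eq_fun do rewrite big_nil; exact: regular_cst.
under eq_fun do rewrite big_cons.
by case: (P j) => //; exact: regular_add.
Qed.

Lemma regular_prod (R : realType) (I : Type) (r : seq I) (P : pred I)
    (F : I -> SL3 R -> R[i]) :
  (forall j, regular (F j)) -> regular (fun x => \prod_(j <- r | P j) F j x).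
Proof.
move=> rF; elim: r => [|j r IHr].
  by under eq_fun do rewrite big_nil; exact: regular_cst.
under eq_fun do rewrite big_cons.
by case: (P j) => //; exact: regular_mul.
Qed.

Lemma regular_minor (R : realType) i J L :
  regular (fun x : SL3 R => minor i J L x).
Proof.
apply: regular_sum => s; apply: regular_mul; first exact: regular_cst.
by apply: regular_prod => j; under eq_fun do rewrite mxE; exact: regular_entry.
Qed.

Lemma regular_comp_act (R : realType) (g h : SL3 R) (f : SL3 R -> R[i]) :
  regular f -> regular (f \o SL3_act g h).
Proof.
elim=> [c|j k|u w _ ru _ rw|u w _ ru _ rw].
- exact: regular_cst.
- have -> : (fun x : SL3 R => x j k) \o SL3_act g h =
      (fun x => \sum_l (\sum_m g j m * x m l) * invmx h l k).
    by apply/funext => x; rewrite /= mxE; apply: eq_bigr => l _; rewrite mxE.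
  apply: regular_sum => l; apply: regular_mul; last exact: regular_cst.
  by apply: regular_sum => m; apply: regular_mul;
    [exact: regular_cst | exact: regular_entry].
- exact: regular_add ru rw.
- exact: regular_mul ru rw.
Qed.

Definition CSL3_cst (R : realType) (c : R[i]) : CSL3 R :=
  MkCSL3 (asboolT (regular_cst c)).

Definition CSL3_minor (R : realType) i (J L : {set 'I_3}) : CSL3 R :=
  MkCSL3 (asboolT (regular_minor R i J L)).

Definition CSL3_translate (R : realType) (g h : SL3 R) (f : CSL3 R) : CSL3 R :=
  MkCSL3 (asboolT (regular_comp_act (SL3_inv g) (SL3_inv h)
    (asboolW (CSL3_regular f)))).

(* ((g, h) . q)(k) = q(g^-1 k h), computed on a representative of q *)
Definition translate (R : realType) (g h : SL3 R) (q : function_field R) :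
    function_field R :=
  FracField.tofrac (CSL3_translate g h (frac (repr q)).1) /
  FracField.tofrac (CSL3_translate g h (frac (repr q)).2).

(* The value at 0 is irrelevant; the trivial valuation is allowed, as it is the
   apex of the valuation cone. *)
Definition discrete_valuation (R : realType) (v : function_field R -> rat) :=
  [/\ forall p q, p != 0 -> q != 0 -> v (p * q) = v p + v q,
      forall p q, p != 0 -> q != 0 -> p + q != 0 ->
        Num.min (v p) (v q) <= v (p + q),
      forall c : R[i], c != 0 -> v (FracField.tofrac (CSL3_cst c)) = 0 &
      exists r : rat, forall q, q != 0 -> exists n : int, v q = n%:~R * r].

Definition invariant_valuation (R : realType) (v : function_field R -> rat) :=
  discrete_valuation v /\
  forall g h q, q != 0 -> v (translate g h q) = v q.

(* A rational coweight of SL_3 is a traceless rational diagonal matrix; weights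
   are written in the basis eps_1, eps_2, eps_3 (modulo eps_1 + eps_2 + eps_3).
   The index i of omega_i starts from 1, the indices j, k of roots from 0. *)
Definition coweight : set 'rV[rat]_3 := [set xi | \sum_j xi 0 j = 0].

Definition pairing (xi : 'rV[rat]_3) (chi : 'rV[int]_3) : rat :=
  \sum_j xi 0 j * (chi 0 j)%:~R.

Definition fundamental_weight (i : nat) : 'rV[int]_3 :=
  \row_(j < 3) (j < i)%N%:Z.

Definition root_weight (j k : 'I_3) : 'rV[int]_3 := delta_mx 0 j - delta_mx 0 k.

Definition antidominant_chamber : set 'rV[rat]_3 :=
  [set xi | coweight xi /\
    forall j k : 'I_3, (j < k)%N -> pairing xi (root_weight j k) <= 0].

(* The leading principal i x i minor f_i is the Borel eigenfunction of weight
   (omega_i, - omega_i): f_i (b k c^-1) = omega_i(b) omega_i(c)^-1 f_i(k) for b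
   lower and c upper triangular.  The coweight attached to an invariant
   valuation v is given by <xi, omega_i> = v(f_i). *)
Definition leading_minor (R : realType) (i : nat) : CSL3 R :=
  CSL3_minor R i [set j : 'I_3 | (j < i)%N] [set j : 'I_3 | (j < i)%N].

Definition valuation_cone (R : realType) : set 'rV[rat]_3 :=
  [set xi | coweight xi /\
    exists v : function_field R -> rat, invariant_valuation v /\
      forall i, (i == 1)%N || (i == 2)%N ->
        pairing xi (fundamental_weight i) =
          v (FracField.tofrac (leading_minor R i))].

Definition coweight_coords (R : realType) (xi : 'rV[rat]_3) : R * R :=
  (ratr (pairing xi (fundamental_weight 1)),
   ratr (pairing xi (fundamental_weight 2))).

Definition real_valuation_cone (R : realType) : set (R * R) :=
  closure (@coweight_coords R @` valuation_cone R).
Arguments real_valuation_cone R : clear implicits.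

Definition logb (R : realType) (t y : R) : R := ln y / ln t.

Definition phi (R : realType) (i : nat) (x : SL3 R) : R :=
  ('C(3, i)%:R)^-1 *
    \sum_(J : {set 'I_3} | #|J| == i) \sum_(L : {set 'I_3} | #|L| == i)
      ComplexField.Normc.normc (minor i J L x) ^+ 2.

Definition sLog (R : realType) (t : R) (x : SL3 R) : R * R :=
  (logb t (phi 1 x), logb t (phi 2 x)).

Definition curve1 (R : realType) (t : R) : set (R * R) :=
  [set (logb t ((2 * x ^+ 3 + 1) / (3 * x ^+ 2)),
        logb t ((2 + x ^+ 3) / (3 * x))) | x in [set x : R | 1 <= x]].

Definition curve2 (R : realType) (t : R) : set (R * R) :=
  [set (logb t ((2 + x ^+ 3) / (3 * x)),
        logb t ((2 * x ^+ 3 + 1) / (3 * x ^+ 2))) | x in [set x : R | 1 <= x]].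

(* A is the set of points lying between C1 and C2 on vertical lines (in either
   order), and the topological boundary of A is the union of C1 and C2.  The
   first clause is needed to select the side: two curves going to infinity from
   a common point cut the plane into two regions with the same boundary. *)
Definition region_bounded_by (R : realType) (A C1 C2 : set (R * R)) : Prop :=
  A = [set y | exists b c, [/\ C1 (y.1, b), C2 (y.1, c) &
                 (b <= y.2 <= c) || (c <= y.2 <= b)]] /\
  closure A `\` A° = C1 `|` C2.

Definition kuratowski_cvg (R : realType) (X : R -> set (R * R))
    (X0 : set (R * R)) : Prop :=
  (forall y, ~ X0 y -> exists2 U, nbhs y U &
     exists2 e : R, 0 < e & forall t, 0 < t < e -> X t `&` U = set0) /\
  (forall y, X0 y -> forall U, nbhs y U ->
     exists2 e : R, 0 < e & forall t, 0 < t < e -> X t `&` U !=set0).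

(* Main.v *)
Require Import Defs.
From mathcomp Require Import all_boot all_order all_algebra perm.
From mathcomp Require Import generic_quotient fraction sesquilinear spectral.
From mathcomp Require Import complex ring lra zify.
From mathcomp Require Import all_classical all_reals all_analysis.

Import Order.TTheory GRing.Theory Num.Theory.
Import numFieldNormedType.Exports.

Local Open Scope classical_set_scope.
Local Open Scope ring_scope.

(** Write [s^n] for the one-parameter subgroup of diagonal matrices with
    exponents [n].  For antidominant [n], the lowest exponent of [s] in
    [f (g s^n h)], for generic [g] and [h], is an invariant valuation of value
    [n_1] on [f_1] and [n_1 + n_2] on [f_2]; it is multiplicative because two
    nonzero regular functions have a common point of non-vanishing.  Conversely
    an invariant valuation [v] takes a single value on all entries of [x], and a
    single one on all entries of [x^-1]; since the principal minors of order 2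
    of [x] are entries of [x^-1] and vice versa, the ultrametric inequality
    yields [2 v(f_1) <= v(f_2)] and [2 v(f_2) <= v(f_1)].

    By the spectral theorem for [x x^*], and since the minors of order 2 of [x]
    are up to sign the entries of [x^-1], the pairs [(3 phi_1 x, 3 phi_2 x)] are
    the pairs [(a + b + c, ab + bc + ca)] with [a, b, c > 0] and [abc = 1], that
    is the pairs [p, q > 0] such that [z^3 - p z^2 + q z - 1] has nonnegative
    discriminant; the two curves correspond to a double root.  The image lies in
    the chamber for every [t] because [p^2 >= 3 q] and [q^2 >= 3 p], and
    images of diagonal matrices come within [ln 3 / |ln t|] of any point of the
    chamber. *)

(** * Orders of regular functions along a one-parameter subgroup of the torus *)

Section OneParameter.
Variable R : realType.
Local Notation C := (complex R).
Implicit Types (g h x : SL3 R) (f u w : SL3 R -> C).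

Lemma SL3_unit x : SL3_mx x \in unitmx.
Proof. by rewrite unitmxE (eqP (SL3_det x)) unitr1. Qed.

Lemma invmx_SL3 x : invmx x = \adj x.
Proof. by rewrite /invmx SL3_unit (eqP (SL3_det x)) invr1 scale1r. Qed.

Definition SL3_one : SL3 R := MkSL3 (SL3_one_proof R).

Lemma regular_det k (A : SL3 R -> 'M[C]_k) :
  (forall i j, regular (fun x => A x i j)) -> regular (fun x => \det (A x)).
Proof.
move=> rA; apply: regular_sum => s; apply: regular_mul; first exact: regular_cst.
exact: regular_prod.
Qed.

Lemma regular_invmx j k : regular (fun x => invmx x j k).
Proof.
have -> : (fun x => invmx x j k) =
    (fun x => (-1) ^+ (k + j) * \det (row' k (col' j x))).
  by apply/funext => x; rewrite invmx_SL3 mxE.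
apply: regular_mul; first exact: regular_cst.
apply: regular_det => a b.
by under eq_fun do rewrite !mxE; exact: regular_entry.
Qed.

(** This is irreducibility of the group: the product of two nonzero regular functions is nonzero
    somewhere. *)
Lemma regular_two_points f f' : regular f -> regular f' ->
  (exists x, f x != 0) -> (exists x, f' x != 0) ->
  exists x, f x != 0 /\ f' x != 0.
Proof.
move=> rf rf' [x fx] [y fy]; have [z] := Defs.regular_mul_neq0 rf rf' fx fy.
by rewrite mulf_eq0 negb_or => /andP[]; exists z.
Qed.

Lemma regular_coefM (P Q : SL3 R -> {poly C}) k :
  (forall i, regular (fun x => (P x)`_i)) ->
  (forall i, regular (fun x => (Q x)`_i)) -> regular (fun x => (P x * Q x)`_k).
Proof.
move=> rP rQ; under eq_fun do rewrite coefM.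
by apply: regular_sum => i; apply: regular_mul.
Qed.

Variable n : 'I_3 -> int.
Hypothesis sum_n : \sum_j n j = 0.

Definition cochar (s : C) : 'M[C]_3 := diag_mx (\row_j s ^ n j).

Lemma det_cochar s : s != 0 -> \det (cochar s) = 1.
Proof.
move=> s0; rewrite /cochar det_diag.
transitivity (s ^ (\sum_j n j)); last by rewrite sum_n.
rewrite !big_ord_recr !big_ord0 /= !mxE mul1r add0r.
by rewrite !expfzDr.
Qed.

Lemma orbit_point_proof g h s : s != 0 -> \det (g *m cochar s *m h) == 1.
Proof.
by move=> s0; rewrite !det_mulmx det_cochar // (eqP (SL3_det g)) (eqP (SL3_det h)) !mulr1.
Qed.

Definition orbit_point g h s (s0 : s != 0) : SL3 R :=
  MkSL3 (orbit_point_proof g h s s0).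

(* [P] encodes the Laurent expansion of [s |-> f (g s^n h)], multiplied by
   [s ^ D] to make it a polynomial. *)
Definition expansion f (D : nat) (P : SL3 R -> SL3 R -> {poly C}) :=
  [/\ forall g h (s : C) (x : SL3 R), s != 0 -> SL3_mx x = g *m cochar s *m h ->
        f x * s ^+ D = (P g h).[s],
      forall h k, regular (fun g => (P g h)`_k) &
      forall g k, regular (fun h => (P g h)`_k)].

(** The exponents [e] are kept general so as to cover entries of [x], with [e = n], and entries of
    the inverse, with [e = - n]. *)
Lemma expansion_sum f (e : 'I_3 -> int) (D : nat) (u w : 'I_3 -> SL3 R -> C) :
  (forall j, regular (u j)) -> (forall j, regular (w j)) ->
  (forall j, 0 <= e j + D%:Z) ->
  (forall g h (s : C) (x : SL3 R), s != 0 -> SL3_mx x = g *m cochar s *m h ->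
     f x = \sum_j u j g * w j h * s ^ e j) ->
  expansion f D (fun g h => \sum_j (u j g * w j h) *: 'X^(`|e j + D%:Z|)).
Proof.
move=> ru rw De Hf; split=> [g h s x s0 xE|h k|g k].
- rewrite (Hf g h s x) // mulr_suml horner_sum; apply: eq_bigr => j _.
  rewrite hornerZ hornerXn -mulrA; congr (_ * _).
  by rewrite !exprnP gez0_abs // expfzDr.
- under eq_fun do rewrite coef_sum.
  apply: regular_sum => j; under eq_fun do rewrite coefZ.
  by do !apply: regular_mul => //; exact: regular_cst.
- under eq_fun do rewrite coef_sum.
  apply: regular_sum => j; under eq_fun do rewrite coefZ.
  by do !apply: regular_mul => //; exact: regular_cst.
Qed.

Lemma entry_orbit (j k : 'I_3) g h s (x : SL3 R) :
  SL3_mx x = g *m cochar s *m h ->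
  x j k = \sum_l g j l * h l k * s ^ n l.
Proof.
move=> ->; rewrite mxE; apply: eq_bigr => l _.
by rewrite mul_mx_diag !mxE mulrAC.
Qed.

Definition shift := (\sum_j `|n j|)%N.

Lemma shift_ge (j : 'I_3) : (`|n j| <= shift)%N.
Proof. by rewrite /shift (bigD1 j) //= leq_addr. Qed.

Lemma expansion_ex f : regular f -> exists D P, expansion f D P.
Proof.
elim=> [c|j k|f1 f2 _ [D [P [HP rP1 rP2]]] _ [D' [P' [HP' rP1' rP2']]]|
  f1 f2 _ [D [P [HP rP1 rP2]]] _ [D' [P' [HP' rP1' rP2']]]].
- exists 0%N, (fun _ _ => c%:P); split=> [g h s x _ _|_ m|_ m].
  + by rewrite mulr1 hornerC.
  + exact: regular_cst.
  + exact: regular_cst.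
- eexists; eexists.
  apply: (@expansion_sum _ n shift (fun l g => g j l) (fun l h => h l k)).
  + by move=> l; exact: regular_entry.
  + by move=> l; exact: regular_entry.
  + by move=> l; have := shift_ge l; lia.
  + by move=> g h s x _; exact: entry_orbit.
(* Both expansions are brought to the common denominator [s ^ (D + D')]. *)
- exists (D + D')%N, (fun g h => P g h * 'X^D' + P' g h * 'X^D).
  split=> [g h s x s0 xE|h k|g k].
  + rewrite hornerD !hornerM !hornerXn -(HP _ _ _ _ s0 xE) -(HP' _ _ _ _ s0 xE).
    by rewrite exprD; ring.
  + under eq_fun do rewrite coefD.
    apply: regular_add; apply: regular_coefM => // i; exact: regular_cst.
  + under eq_fun do rewrite coefD.
    apply: regular_add; apply: regular_coefM => // i; exact: regular_cst.
- exists (D + D')%N, (fun g h => P g h * P' g h).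
  split=> [g h s x s0 xE|h k|g k].
  + rewrite hornerM -(HP _ _ _ _ s0 xE) -(HP' _ _ _ _ s0 xE).
    by rewrite exprD; ring.
  + exact: regular_coefM.
  + exact: regular_coefM.
Qed.

(** Coefficients below [k] vanish for all [g] and [h], while the one at [k] need only be nonzero
    somewhere: this is the order for generic [g] and [h]. *)
Definition lowest (P : SL3 R -> SL3 R -> {poly C}) (k : nat) :=
  (forall g h j, (j < k)%N -> (P g h)`_j = 0) /\ exists g h, (P g h)`_k != 0.

Definition has_order f (m : int) := exists D P k,
  [/\ expansion f D P, lowest P k & m = k%:Z - D%:Z].

Lemma poly_eq_punctured (p q : {poly C}) :
  (forall s, s != 0 -> p.[s] = q.[s]) -> p = q.
Proof.
move=> pq; apply/eqP; rewrite -subr_eq0; apply/negPn/negP => pq0.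
(* The roots [1, 2, ...] start from 1 since the hypothesis says nothing at 0. *)
pose r := [seq (i.+1%:R : C) | i <- iota 0 (size (p - q))].
have ur : uniq r.
  rewrite map_inj_uniq ?iota_uniq // => a b /eqP.
  by rewrite eqr_nat => /eqP[].
have := max_poly_roots pq0 _ ur; rewrite size_map size_iota ltnn => H.
suff: false by []. 
apply: H; apply/allP => _ /mapP[i _ ->].
by rewrite /root hornerD hornerN pq ?pnatr_eq0 // subrr.
Qed.

(** For [s != 0] both sides evaluate to [f (g s^n h) * s ^ (D + D')]. *)
Lemma expansion_unique f D P D' P' : expansion f D P -> expansion f D' P' ->
  forall g h, P g h * 'X^D' = P' g h * 'X^D.
Proof.
move=> [H _ _] [H' _ _] g h; apply: poly_eq_punctured => s s0.
rewrite !hornerM !hornerXn.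
rewrite -(H g h s (orbit_point g h s s0)) // -(H' g h s (orbit_point g h s s0)) //.
by ring.
Qed.

(** By uniqueness of expansions, a nonzero coefficient of index [k'] in [P'] is a coefficient of
    index [k' + D - D'] in [P], hence not below [k]. *)
Lemma has_order_le f m m' : has_order f m -> has_order f m' -> m <= m'.
Proof.
move=> [D [P [k [eP [lP _] ->]]]] [D' [P' [k' [eP' [_ [g [h nP]]] ->]]]].
suff : (k + D' <= k' + D)%N by lia.
rewrite leqNgt; apply/negP => lt; move/eqP: nP; apply.
have := congr1 (fun p : {poly C} => p`_(k' + D)) (expansion_unique _ _ _ _ _ eP eP' g h).
rewrite !coefMXn [in RHS]ltnNge leq_addl /= addnK => <-.
by case: ltnP => // ?; rewrite lP //; lia.
Qed.

Lemma has_order_unique f m m' : has_order f m -> has_order f m' -> m = m'.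
Proof.
by move=> fm fm'; apply: le_anti; rewrite !(has_order_le f).
Qed.

Lemma has_order_ex f : regular f -> (exists x, f x != 0) -> exists m, has_order f m.
Proof.
move=> rf [x fx]; have [D [P eP]] := expansion_ex f rf.
have [H _ _] := eP.
(* At [g = x], [h = 1] and [s = 1] the orbit point is [x] itself, where [f] does not vanish. *)
have Px : P x SL3_one != 0.
  apply: contraNneq fx => P0; have := H x SL3_one 1 x.
  rewrite P0 horner0 expr1n mulr1 oner_neq0 => -> //.
  rewrite mulmx1; have -> : cochar 1 = 1%:M; last by rewrite mulmx1.
  by apply/matrixP => i j; rewrite !mxE exp1rz.
have exk : exists k, `[< exists g h, (P g h)`_k != 0 >].
  exists (size (P x SL3_one)).-1; apply/asboolP; exists x, SL3_one.
  by rewrite -[_`_ _]/(lead_coef _) lead_coef_eq0.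
case: (ex_minnP exk) => k /asboolP Pk min_k.
exists (k%:Z - D%:Z), D, P, k; split=> //; split=> // g h j jk.
apply/eqP/negPn/negP => nz.
by have := min_k j; rewrite leqNgt jk => /(_ _)/negP; case => //; apply/asboolP; exists g, h.
Qed.

Lemma coefM_lowest (p q : {poly C}) k l :
  (forall j, (j < k)%N -> p`_j = 0) -> (forall j, (j < l)%N -> q`_j = 0) ->
  (p * q)`_(k + l) = p`_k * q`_l /\
  forall j, (j < k + l)%N -> (p * q)`_j = 0.
Proof.
move=> p0 q0; split=> [|j jkl]; rewrite coefM.
  have kP : (k < (k + l).+1)%N by rewrite ltnS leq_addr.
  rewrite (bigD1 (Ordinal kP)) //= addKn big1 ?addr0 // => i /eqP ik.
  have [/p0->|ki|E] := ltngtP i k; rewrite ?mul0r //.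
    by rewrite q0 ?mulr0 //; have := ltn_ord i; lia.
  by case: ik; apply: val_inj.
apply: big1 => i _; have [ik|ki] := ltnP i k; first by rewrite p0 ?mul0r.
by rewrite q0 ?mulr0 //; have := ltn_ord i; lia.
Qed.

(** The lowest coefficients of [P] and [P'] are regular in [g] and in [h] separately. Irreducibility
    first gives a [g0] suiting both, then an [h0]; at this common point the product of the lowest
    coefficients is nonzero. *)
Lemma has_orderM f f' m m' : has_order f m -> has_order f' m' ->
  has_order (fun x => f x * f' x) (m + m').
Proof.
move=> [D [P [k [[H r1 r2] [lP [g [h nP]]] ->]]]].
move=> [D' [P' [k' [[H' r1' r2'] [lP' [g' [h' nP']]] ->]]]].
have [g0 [n1 n2]] := regular_two_points _ _ (r1 h k) (r1' h' k')
  (ex_intro _ g nP) (ex_intro _ g' nP').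
have [h0 [n3 n4]] := regular_two_points _ _ (r2 g0 k) (r2' g0 k')
  (ex_intro _ h n1) (ex_intro _ h' n2).
exists (D + D')%N, (fun g h => P g h * P' g h), (k + k')%N; split; last by lia.
- split=> [g1 h1 s x s0 xE|h1 i|g1 i].
  + rewrite hornerM -(H _ _ _ _ s0 xE) -(H' _ _ _ _ s0 xE).
    by rewrite exprD; ring.
  + exact: regular_coefM.
  + exact: regular_coefM.
- split=> [g1 h1 j jk|].
    by have [_ ->] := coefM_lowest (P g1 h1) (P' g1 h1) k k' (lP g1 h1) (lP' g1 h1).
  exists g0, h0.
  have [-> _] := coefM_lowest (P g0 h0) (P' g0 h0) k k' (lP g0 h0) (lP' g0 h0).
  by rewrite mulf_neq0.
Qed.

Lemma has_orderD f f' m m' m'' : has_order f m -> has_order f' m' ->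
  has_order (fun x => f x + f' x) m'' -> Num.min m m' <= m''.
Proof.
move=> [D [P [k [[H r1 r2] [lP _] ->]]]].
move=> [D' [P' [k' [[H' r1' r2'] [lP' _] ->]]]].
move=> [D2 [P2 [k2 [e2 [_ [g [h n2]]] ->]]]].
have e : expansion (fun x => f x + f' x) (D + D')
    (fun g h => P g h * 'X^D' + P' g h * 'X^D).
  split=> [g1 h1 s x s0 xE|h1 i|g1 i].
  + rewrite hornerD !hornerM !hornerXn -(H _ _ _ _ s0 xE) -(H' _ _ _ _ s0 xE).
    by rewrite exprD; ring.
  + under eq_fun do rewrite coefD.
    apply: regular_add; apply: regular_coefM => // j; exact: regular_cst.
  + under eq_fun do rewrite coefD.
    apply: regular_add; apply: regular_coefM => // j; exact: regular_cst.
rewrite leNgt lt_min; apply/negP => /andP[l1 l2]; move/eqP: n2; apply.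
have := congr1 (fun p : {poly C} => p`_(k2 + (D + D'))) (expansion_unique _ _ _ _ _ e e2 g h).
rewrite !coefMXn [in RHS]ltnNge leq_addl /= addnK => <-.
case: ltnP => // ?; rewrite coefD !coefMXn.
case: ltnP => // ?; case: ltnP => // ?; rewrite ?lP ?lP' ?add0r //; lia.
Qed.

Lemma has_order_cst (c : C) : c != 0 -> has_order (fun=> c) 0.
Proof.
move=> c0; exists 0%N, (fun _ _ => c%:P), 0%N; split=> //.
- by split=> [g h s x _ _|_ m|_ m]; [rewrite mulr1 hornerC | exact: regular_cst..].
- by split=> [g h j|]; [rewrite ltn0 | exists SL3_one, SL3_one; rewrite coefC].
Qed.

Lemma SL3_actV g h : cancel (SL3_act g h) (SL3_act (SL3_inv g) (SL3_inv h)).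
Proof.
move=> x; apply: val_inj => /=.
rewrite !mulmxA mulVmx ?SL3_unit // mul1mx -mulmxA mulmxV ?mulmx1 //.
by rewrite unitmx_inv SL3_unit.
Qed.

(** Acting by [(g0, h0)] replaces [g] by [g0 g] and [h] by [h h0^-1], a bijective substitution which
    keeps coefficients regular. *)
Lemma has_order_act f g0 h0 m : has_order f m -> has_order (f \o SL3_act g0 h0) m.
Proof.
move=> [D [P [k [[H r1 r2] [lP [g [h nP]]] ->]]]].
exists D, (fun g h => P (SL3_act g0 SL3_one g) (SL3_act SL3_one h0 h)), k.
split=> //.
- split=> [g' h' s x s0 xE|h' i|g' i].
  + apply: H => //=; rewrite xE invmx1 mul1mx mulmx1.
    by rewrite !mulmxA.
  + exact: (regular_comp_act g0 SL3_one (r1 (SL3_act SL3_one h0 h') i)).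
  + exact: (regular_comp_act SL3_one h0 (r2 (SL3_act g0 SL3_one g') i)).
- split=> [g' h'|]; first exact: lP.
  exists (SL3_act (SL3_inv g0) SL3_one g), (SL3_act SL3_one (SL3_inv h0) h).
  suff [-> ->] : SL3_act g0 SL3_one (SL3_act (SL3_inv g0) SL3_one g) = g /\
    SL3_act SL3_one h0 (SL3_act SL3_one (SL3_inv h0) h) = h by [].
  split; apply: val_inj => /=.
    by rewrite invmx1 !mulmx1 mulmxA mulmxV ?SL3_unit ?mul1mx.
  by rewrite !mul1mx invmxK mulmxK ?SL3_unit.
Qed.

(** Several exponents may equal the minimum [e l], and their terms could cancel; the condition at
    the identity leaves only the term [l] there, so the lowest coefficient is not identically
    zero. *)
Lemma has_order_sum f (e : 'I_3 -> int) (u w : 'I_3 -> SL3 R -> C) (l : 'I_3) :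
  (forall j, regular (u j)) -> (forall j, regular (w j)) ->
  (forall j, e l <= e j) ->
  (forall j, u j SL3_one * w j SL3_one = (j == l)%:R) ->
  (forall g h (s : C) (x : SL3 R), s != 0 -> SL3_mx x = g *m cochar s *m h ->
     f x = \sum_j u j g * w j h * s ^ e j) ->
  has_order f (e l).
Proof.
move=> ru rw le_e uw Hf; pose D := (\sum_j `|e j|)%N.
have De j : 0 <= e j + D%:Z.
  have : (`|e j| <= D)%N by rewrite /D (bigD1 j) //= leq_addr.
  by lia.
eexists; eexists; exists (absz (e l + D%:Z)); split.
- exact: (expansion_sum f e D u w).
- split=> [g h j jl|].
    rewrite coef_sum big1 // => i _; rewrite coefZ coefXn.
    case: eqP => [E|]; last by rewrite mulr0.
    by have := le_e i; have := De i; have := De l; lia.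
  exists SL3_one, SL3_one; rewrite coef_sum (bigD1 l) //= big1 ?addr0.
    by rewrite uw eqxx scale1r coefXn eqxx oner_neq0.
  by move=> j /negPf jl; rewrite uw jl scale0r coef0.
- by have := De l; lia.
Qed.

Lemma has_order_entry (l : 'I_3) : (forall j, n l <= n j) ->
  has_order (fun x => x l l) (n l).
Proof.
move=> le_n; apply: (has_order_sum _ n (fun i g => g l i) (fun i h => h i l)).
- by move=> j; exact: regular_entry.
- by move=> j; exact: regular_entry.
- by [].
- by move=> j; rewrite !mxE eq_sym; case: eqP; rewrite ?mulr1 ?mulr0.
- by move=> g h s x _; exact: entry_orbit.
Qed.

(** The inverse of [g s^n h] is [h^-1 s^(-n) g^-1], so the largest [n] gives the lowest exponent. *)
Lemma has_order_invmx (l : 'I_3) : (forall j, n j <= n l) ->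
  has_order (fun x => invmx x l l) (- n l).
Proof.
move=> le_n; apply: (has_order_sum _ (fun j => - n j)
  (fun i g => invmx g i l) (fun i h => invmx h l i)).
- by move=> j; exact: regular_invmx.
- by move=> j; exact: regular_invmx.
- by move=> j; rewrite lerN2.
- by move=> j /=; rewrite invmx1 !mxE eq_sym; case: eqP; rewrite ?mulr1 ?mulr0.
move=> g h s x s0 xE; have -> : invmx x =
    invmx h *m diag_mx (\row_j s ^ (- n j)) *m invmx g.
  have xV : SL3_mx x *m (invmx h *m diag_mx (\row_j s ^ (- n j)) *m invmx g) = 1%:M.
    rewrite xE !mulmxA -(mulmxA _ (SL3_mx h)) mulmxV ?SL3_unit // mulmx1.
    rewrite -(mulmxA (SL3_mx g)) -[RHS](mulmxV (SL3_unit g)); congr (_ *m _).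
    rewrite -[RHS]mulmx1; congr (_ *m _).
    apply/matrixP => i j; rewrite mul_diag_mx !mxE.
    by case: eqP => [->|]; rewrite ?mulr0n ?mulr0 // -expfzDr // subrr.
  by rewrite -[RHS](mulKmx (SL3_unit x)) xV mulmx1.
rewrite mxE; apply: eq_bigr => i _; rewrite mul_mx_diag !mxE.
by ring.
Qed.

(** The default 0 is taken only at the zero function, as every other regular function has an
    order. *)
Definition ord (f : CSL3 R) : int :=
  if pselect (exists m, has_order f m) is left H then sval (cid H) else 0.

Lemma CSL3_neq0 (f : CSL3 R) : f != 0 -> exists x, f x != 0.
Proof.
move=> f0; apply: contrapT => /forallNP H; move/eqP: f0; apply.
by apply/val_inj/funext => x; have /negP/negPn/eqP := H x.
Qed.

Lemma ordP (f : CSL3 R) : f != 0 -> has_order f (ord f).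
Proof.
move=> /CSL3_neq0/(has_order_ex _ (asboolW (CSL3_regular f))) H.
by rewrite /ord; case: pselect => // H'; case: (cid H').
Qed.

Lemma ordE (f : CSL3 R) m : has_order f m -> ord f = m.
Proof.
move=> fm; rewrite /ord; case: pselect => [H|[]]; last by exists m.
by case: (cid H) => m' /= /has_order_unique; apply.
Qed.

Lemma ordM (f g : CSL3 R) : f != 0 -> g != 0 -> ord (f * g) = ord f + ord g.
Proof.
by move=> /ordP Hf /ordP Hg; apply: ordE; exact: has_orderM Hf Hg.
Qed.

Lemma ordD (f g : CSL3 R) : f != 0 -> g != 0 -> f + g != 0 ->
  Num.min (ord f) (ord g) <= ord (f + g).
Proof. by move=> /ordP Hf /ordP Hg /ordP; exact: has_orderD Hf Hg. Qed.

Lemma CSL3_cst_neq0 (c : C) : c != 0 -> CSL3_cst c != 0.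
Proof.
apply: contra_neq => /(congr1 (fun f : CSL3 R => f SL3_one)); exact.
Qed.

Lemma ord_cst (c : C) : c != 0 -> ord (CSL3_cst c) = 0.
Proof. by move=> c0; apply: ordE; exact: has_order_cst. Qed.

Lemma CSL3_translate_neq0 g h (f : CSL3 R) : f != 0 -> CSL3_translate g h f != 0.
Proof.
move=> /CSL3_neq0[x fx]; apply: contraNneq fx.
move=> /(congr1 (fun f : CSL3 R => f (SL3_act g h x))).
by rewrite /= SL3_actV => ->.
Qed.

Lemma ord_translate g h (f : CSL3 R) : f != 0 ->
  ord (CSL3_translate g h f) = ord f.
Proof. by move=> /ordP Hf; apply: ordE; exact: has_order_act. Qed.

(** * Extension of the order to an invariant valuation of the function field *)

Local Notation "f %:F" := (@FracField.tofrac (CSL3 R) f).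

(** Translates and valuations are computed on the representative chosen by the quotient; this
    relates it to the fraction it represents. *)
Lemma frac_reprE (q : function_field R) :
  q = (frac (repr q)).1%:F / (frac (repr q)).2%:F.
Proof.
have d0 : (frac (repr q)).2 != 0 by rewrite denom_ratioP.
have dF : (frac (repr q)).2%:F != 0 by rewrite tofrac_eq0.
apply: (mulIf dF); rewrite divfK // -{1}[q]reprK.
unlock FracField.tofrac; rewrite -[LHS]FracField.pi_mul; apply/eqmodP.
rewrite /= FracField.equivfE /FracField.mulf /=.
rewrite !numden_Ratio ?mulr1 ?oner_neq0 //; first by rewrite mulrC.
Qed.

(** Division by [N] realises the rational coweight [n / N]. *)
Definition order_valuation (N : nat) (q : function_field R) : rat :=
  (ord (frac (repr q)).1 - ord (frac (repr q)).2)%:~R / N%:R.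

(** Independence of the representative: two fractions that agree satisfy [a d = n' b], and [ord] is
    additive on products. *)
Lemma order_valuationE N (a b : CSL3 R) : a != 0 -> b != 0 ->
  order_valuation N (a%:F / b%:F) = (ord a - ord b)%:~R / N%:R.
Proof.
move=> a0 b0; rewrite /order_valuation; congr (_%:~R / _).
set q := _ / _; have := frac_reprE q; rewrite /q.
have := denom_ratioP (repr q).
move: (frac (repr q)).1 (frac (repr q)).2 => n' d d0 E.
have aF : a%:F != 0 by rewrite tofrac_eq0.
have bF : b%:F != 0 by rewrite tofrac_eq0.
have dF : d%:F != 0 by rewrite tofrac_eq0.
have qF : a%:F / b%:F != 0 by rewrite mulf_eq0 invr_eq0 (negPf aF) (negPf bF).
have n0 : n' != 0.
  by apply/eqP => n0; move: qF; rewrite E n0 tofrac0 mul0r eqxx.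
have /eqP : (a * d)%:F = (n' * b)%:F.
  by rewrite !tofracM; apply/eqP; rewrite -(eqr_div _ _ bF dF) -E eqxx.
rewrite tofrac_eq => /eqP/(congr1 ord).
by rewrite (ordM _ _ a0 d0) (ordM _ _ n0 b0); lia.
Qed.

Lemma order_valuation_tofrac N (a : CSL3 R) : a != 0 ->
  order_valuation N a%:F = (ord a)%:~R / N%:R.
Proof.
move=> a0; rewrite -[a%:F]divr1 -tofrac1 order_valuationE ?oner_neq0 //.
have -> : (1 : CSL3 R) = CSL3_cst 1 by apply: val_inj.
by rewrite ord_cst ?oner_neq0 // subr0.
Qed.

Lemma fracP (q : function_field R) : q != 0 ->
  exists a b, [/\ a != 0, b != 0 & q = a%:F / b%:F].
Proof.
rewrite (frac_reprE q) => q0; do 2!eexists; split; last by [].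
  by apply: contraNneq q0 => ->; rewrite tofrac0 mul0r.
by rewrite denom_ratioP.
Qed.

Lemma order_valuation_discrete N : discrete_valuation (order_valuation N).
Proof.
split.
- move=> p q /fracP[a [b [a0 b0 ->]]] /fracP[c [d [c0 d0 ->]]].
  have ac0 : a * c != 0 by rewrite mulf_eq0 (negPf a0) (negPf c0).
  have bd0 : b * d != 0 by rewrite mulf_eq0 (negPf b0) (negPf d0).
  rewrite mulrACA -invfM -!tofracM (order_valuationE _ _ _ ac0 bd0).
  rewrite (order_valuationE _ _ _ a0 b0) (order_valuationE _ _ _ c0 d0).
  rewrite (ordM _ _ a0 c0) (ordM _ _ b0 d0).
  by rewrite -mulrDl -intrD; congr (_%:~R / _); ring.
- move=> p q /fracP[a [b [a0 b0 ->]]] /fracP[c [d [c0 d0 ->]]].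
  have bF : b%:F != 0 by rewrite tofrac_eq0.
  have dF : d%:F != 0 by rewrite tofrac_eq0.
  rewrite (addf_div _ _ bF dF) -!tofracM -tofracD => nz.
  have s0 : a * d + c * b != 0.
    by apply: contraNneq nz => ->; rewrite tofrac0 mul0r.
  have bd0 : b * d != 0 by rewrite mulf_eq0 (negPf b0) (negPf d0).
  have ad0 : a * d != 0 by rewrite mulf_eq0 (negPf a0) (negPf d0).
  have cb0 : c * b != 0 by rewrite mulf_eq0 (negPf c0) (negPf b0).
  rewrite (order_valuationE _ _ _ a0 b0) (order_valuationE _ _ _ c0 d0).
  rewrite (order_valuationE _ _ _ s0 bd0).
  rewrite -minr_pMl ?invr_ge0 ?ler0n // ler_wpM2r ?invr_ge0 ?ler0n //.
  have := ordD _ _ ad0 cb0 s0.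
  rewrite (ordM _ _ a0 d0) (ordM _ _ c0 b0) (ordM _ _ b0 d0).
  rewrite !ge_min !ler_int.
  move: (ord a) (ord b) (ord c) (ord d) (ord (_ + _)); clear => i j k l m.
  by case/orP => H; apply/orP; [left | right]; lia.
- by move=> c c0; rewrite order_valuation_tofrac ?CSL3_cst_neq0 // ord_cst ?mul0r.
- exists N%:R^-1; move=> _ /fracP[a [b [a0 b0 ->]]]; exists (ord a - ord b).
  exact: order_valuationE.
Qed.

Lemma order_valuation_invariant N : invariant_valuation (order_valuation N).
Proof.
split; first exact: order_valuation_discrete.
move=> g h q q0; have d0 := denom_ratioP (repr q).
have n0 : (frac (repr q)).1 != 0.
  by apply: contraNneq q0 => E; rewrite (frac_reprE q) E tofrac0 mul0r.
by rewrite /translate order_valuationE ?CSL3_translate_neq0 // !ord_translate.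
Qed.

End OneParameter.

(** * Minors of order 1 and 2 of matrices of size 3 *)

Section Minors.
Variable K : comNzRingType.

(** Both lists are strictly increasing and have the same elements. *)
Lemma enum_setC1 m (k : 'I_m.+1) : enum [set~ k]%SET = map (lift k) (enum 'I_m).
Proof.
have tr : transitive (fun i j : 'I_m.+1 => (i < j)%N).
  by move=> i j l; exact: ltn_trans.
apply: (irr_sorted_eq tr) => [i||| i]; first exact: ltnn.
- rewrite /enum_mem; apply: sorted_filter => //.
  have := iota_ltn_sorted 0 m.+1; rewrite -val_enum_ord sorted_map.
  by rewrite -enumT.
- rewrite sorted_map; have := iota_ltn_sorted 0 m.
  rewrite -val_enum_ord sorted_map; apply: sub_sorted => i j /= ij.
  by rewrite /bump; lia.
- rewrite mem_enum in_setC1; apply/idP/mapP => [ik|[j _ ->]].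
    rewrite eq_sym in ik; have [j -> _] := unlift_some ik.
    by exists j; rewrite ?mem_enum.
  by rewrite eq_sym neq_lift.
Qed.

Lemma det_mx2 (A : 'M[K]_2) : \det A = A 0 0 * A 1 1 - A 0 1 * A 1 0.
Proof.
rewrite (expand_det_row A 0) !big_ord_recl big_ord0 /cofactor !det_mx11 !mxE.
rewrite /= expr0 expr1 addr0 mul1r mulN1r mulrN.
by congr (_ * A _ _ - A _ _ * A _ _); apply: val_inj.
Qed.

Lemma minor1E (j k : 'I_3) (x : 'M[K]_3) : minor 1 [set j]%SET [set k]%SET x = x j k.
Proof. by rewrite /minor det_mx11 mxE !enum_set1. Qed.

Lemma minor2E (j k : 'I_3) (x : 'M[K]_3) :
  minor 2 [set~ j]%SET [set~ k]%SET x = \det (row' j (col' k x)).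
Proof.
congr (\det _); apply/matrixP => a b; rewrite !mxE !enum_setC1.
by rewrite -?enumT !(nth_map ord0) -?enumT ?size_enum_ord // !nth_ord_enum.
Qed.

End Minors.

(** * Inequalities satisfied by every invariant valuation *)

Section Cone.
Variable R : realType.
Local Notation C := (complex R).
Implicit Types (g h x : SL3 R) (f : CSL3 R).

Local Notation "f %:F" := (@FracField.tofrac (CSL3 R) f).

Lemma leading_minor1E x : leading_minor R 1 x = x ord0 ord0.
Proof.
rewrite /= (_ : finset _ = [set ord0]%SET) ?minor1E //.
by apply/setP => -[[|i] i3]; rewrite !inE.
Qed.

Lemma invmx_diag x (l : 'I_3) : invmx x l l = \det (row' l (col' l x)).
Proof.
by rewrite invmx_SL3 mxE /cofactor addnn -signr_odd odd_double expr0 mul1r.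
Qed.

(** The first two indices are the complement of the last one, the cofactor on the diagonal has sign
    1, and the determinant is 1. *)
Lemma leading_minor2E x : leading_minor R 2 x = invmx x ord_max ord_max.
Proof.
rewrite invmx_diag -minor2E /= (_ : finset _ = [set~ ord_max]%SET) //.
apply/setP => i; rewrite !inE; have := ltn_ord i.
by rewrite -(inj_eq val_inj) /=; lia.
Qed.

Definition entry (j k : 'I_3) : CSL3 R :=
  MkCSL3 (asboolT (regular_entry R j k)).
Definition inv_entry (j k : 'I_3) : CSL3 R :=
  MkCSL3 (asboolT (regular_invmx R j k)).

(** Addition of [j] modulo 3: these cyclic permutations act transitively on the indices, and being
    even they have matrices of determinant 1. *)
Definition shift_perm (j : 'I_3) : {perm 'I_3} := perm (addrI j).

(** The cube of the permutation is the identity, and a sign equals its own cube. *)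
Lemma odd_shift_perm j : odd_perm (shift_perm j) = false.
Proof.
have : odd_perm (shift_perm j * shift_perm j * shift_perm j)%g = false.
  suff -> : (shift_perm j * shift_perm j * shift_perm j)%g = 1%g.
    by rewrite odd_perm1.
  apply/permP => i; rewrite perm1 !permM !permE.
  by apply/val_inj; case: i => [[|[|[|]]]] //=; case: j => [[|[|[|]]]].
by rewrite !odd_permM; case: (odd_perm _).
Qed.

Lemma det_shift_perm j : \det (perm_mx (shift_perm j) : 'M[C]_3) == 1.
Proof. by rewrite det_perm odd_shift_perm. Qed.

Definition SL3_shift j : SL3 R := MkSL3 (det_shift_perm j).

Lemma act_shift (j k : 'I_3) x a b :
  SL3_act (SL3_shift j) (SL3_shift k) x a b = x (j + a) (k + b).
Proof.
rewrite /SL3_act /=.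
have <- : perm_mx (shift_perm k)^-1%g = invmx (SL3_shift k) := perm_mxV _ _.
by rewrite -col_permE -row_permE !mxE !permE.
Qed.

Lemma inv_act_shift (j k : 'I_3) x a b :
  invmx (SL3_act (SL3_shift j) (SL3_shift k) x) a b = invmx x (k + a) (j + b).
Proof.
suff -> : invmx (SL3_act (SL3_shift j) (SL3_shift k) x) =
  SL3_act (SL3_shift k) (SL3_shift j) (SL3_inv x) :> 'M[C]_3.
  exact: act_shift.
have H : SL3_act (SL3_shift j) (SL3_shift k) x *m
    SL3_act (SL3_shift k) (SL3_shift j) (SL3_inv x) = 1%:M.
  rewrite /= !mulmxA mulmxKV ?(SL3_unit _ (SL3_shift k)) //.
  by rewrite mulmxK ?SL3_unit // mulmxV // (SL3_unit _ (SL3_shift j)).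
by rewrite -[RHS](mulKmx (SL3_unit _ (SL3_act (SL3_shift j) (SL3_shift k) x))) H mulmx1.
Qed.

Lemma CSL3_neq0_at f x : f x != 0 -> f != 0.
Proof. by apply: contraNneq => ->. Qed.

Lemma det_minor_diag (K : comNzRingType) (A : 'M[K]_3) (l : 'I_3) :
  let p := lift l ord0 in let q := lift l ord_max in
  \det (row' l (col' l A)) = A p p * A q q - A p q * A q p.
Proof.
rewrite /= det_mx2 !mxE.
by rewrite (_ : 0 = ord0 :> 'I_2) // (_ : 1 = ord_max :> 'I_2) //; apply: val_inj.
Qed.

Variable v : function_field R -> rat.
Hypothesis v_inv : invariant_valuation v.

(** [translate] works on a representative [n / d] of [f]. From [f d = n], the translate of [n] is
    [f'] times that of [d], so the quotient is [f'] for any representative. *)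
Lemma valuation_act f g h (f' : CSL3 R) : f != 0 ->
  (forall x, f' x = f (SL3_act g h x)) -> v f'%:F = v f%:F.
Proof.
move=> f0 ff'; have [_ H] := v_inv.
have fF : f%:F != 0 by rewrite tofrac_eq0.
rewrite -(H (SL3_inv g) (SL3_inv h) _ fF); congr v.
have tr_ext : CSL3_translate (SL3_inv g) (SL3_inv h) f = f'.
  apply/val_inj/funext => x; rewrite /= ff'; congr (f _); apply: val_inj => /=.
  by rewrite !invmxK.
rewrite -tr_ext /translate.
have := frac_reprE _ f%:F; have d0 := denom_ratioP (repr f%:F).
move: (frac (repr _)).1 (frac (repr _)).2 d0 => n d d0 E.
have dF : d%:F != 0 by rewrite tofrac_eq0.
have TdF : (CSL3_translate (SL3_inv g) (SL3_inv h) d)%:F != 0.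
  by rewrite tofrac_eq0 CSL3_translate_neq0.
have /eqP : (f * d)%:F = n%:F by rewrite tofracM E (divfK dF).
rewrite tofrac_eq => /eqP <-; apply: (mulIf TdF); rewrite (divfK TdF) -tofracM.
by congr (_%:F); apply: val_inj.
Qed.

(** A minor of order 2 is a difference of two products of value [2 * m], and the constant -1 has
    value 0. The family [c] stands for the entries of [x] or for those of its inverse. *)
Lemma valuation_minor_ge (c : 'I_3 -> 'I_3 -> CSL3 R) (f : CSL3 R) (l : 'I_3) m :
  (forall j k, c j k != 0 /\ v (c j k)%:F = m) -> f != 0 ->
  (forall x, f x = \det (row' l (col' l (\matrix_(j, k) c j k x)))) ->
  2 * m <= v f%:F.
Proof.
have [[vM vD vC _] _] := v_inv.
move=> Hc f0 Hf; pose p := lift l ord0; pose q := lift l ord_max.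
have cF j k : (c j k)%:F != 0 by rewrite tofrac_eq0; case: (Hc j k).
have vc j k : v (c j k)%:F = m by case: (Hc j k).
have N1 : (-1 : C) != 0 by rewrite oppr_eq0 oner_neq0.
have N1F : (CSL3_cst (-1) : CSL3 R)%:F != 0 by rewrite tofrac_eq0 CSL3_cst_neq0.
have fE : f = c p p * c q q + CSL3_cst (-1) * (c p q * c q p).
  apply/val_inj/funext => x; rewrite [LHS]Hf det_minor_diag !mxE; congr (_ + _).
  by rewrite -[LHS]mulN1r.
have fF : f%:F != 0 by rewrite tofrac_eq0.
move: fF; rewrite fE tofracD !tofracM => fF.
have pF : (c p p)%:F * (c q q)%:F != 0 by rewrite mulf_eq0 (negPf (cF _ _)) (negPf (cF _ _)).
have qF : (c p q)%:F * (c q p)%:F != 0 by rewrite mulf_eq0 (negPf (cF _ _)) (negPf (cF _ _)).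
have qF' : (CSL3_cst (-1))%:F * ((c p q)%:F * (c q p)%:F) != 0.
  by rewrite mulf_eq0 (negPf N1F) (negPf qF).
have := vD _ _ pF qF' fF.
rewrite (vM _ _ N1F qF) (vM _ _ (cF p q) (cF q p)) (vM _ _ (cF p p) (cF q q)).
by rewrite (vC _ N1) add0r !vc minxx mulr2n mulrDl mul1r.
Qed.

(** Cyclic permutations of rows and columns carry the first entry to any other, and [v] is invariant
    under them. *)
Lemma valuation_entry j k :
  entry j k != 0 /\ v (entry j k)%:F = v (leading_minor R 1)%:F.
Proof.
have E : leading_minor R 1 = entry ord0 ord0.
  by apply/val_inj/funext => x; exact: leading_minor1E.
have act x : entry j k x = entry ord0 ord0 (SL3_act (SL3_shift j) (SL3_shift k) x).
  by rewrite /entry [RHS]act_shift !addr0.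
have e0 : entry ord0 ord0 != 0.
  apply: (@CSL3_neq0_at _ (SL3_one R)).
  by rewrite /= mxE eqxx oner_neq0.
split; last by rewrite E; exact: valuation_act act.
apply: (@CSL3_neq0_at _
  (SL3_act (SL3_inv (SL3_shift j)) (SL3_inv (SL3_shift k)) (SL3_one R))).
rewrite act.
have <- : SL3_one R = SL3_act (SL3_shift j) (SL3_shift k)
    (SL3_act (SL3_inv (SL3_shift j)) (SL3_inv (SL3_shift k)) (SL3_one R)).
  apply: val_inj => /=; rewrite invmxK mulmx1 !mulmxA mulmxV ?(SL3_unit _ (SL3_shift j)) //.
  by rewrite mul1mx mulmxV // (SL3_unit _ (SL3_shift k)).
by rewrite /= mxE eqxx oner_neq0.
Qed.

Lemma valuation_inv_entry j k :
  inv_entry j k != 0 /\ v (inv_entry j k)%:F = v (leading_minor R 2)%:F.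
Proof.
have E : leading_minor R 2 = inv_entry ord_max ord_max.
  by apply/val_inj/funext => x; exact: leading_minor2E.
(* Inversion exchanges the two sides of the action, so the row index [j] of the inverse is moved by
   [b] and the column index [k] by [a]. *)
pose a := SL3_shift (k - ord_max); pose b := SL3_shift (j - ord_max).
have act x : inv_entry j k x = inv_entry ord_max ord_max (SL3_act a b x).
  by rewrite /inv_entry [RHS]inv_act_shift !subrK.
have e0 : inv_entry ord_max ord_max != 0.
  apply: (@CSL3_neq0_at _ (SL3_one R)).
  by rewrite /= invmx1 mxE eqxx oner_neq0.
split; last by rewrite E; exact: valuation_act act.
apply: (@CSL3_neq0_at _ (SL3_act (SL3_inv a) (SL3_inv b) (SL3_one R))).
rewrite act.
have <- : SL3_one R = SL3_act a b (SL3_act (SL3_inv a) (SL3_inv b) (SL3_one R)).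
  apply: val_inj => /=; rewrite invmxK mulmx1 !mulmxA mulmxV ?(SL3_unit _ a) //.
  by rewrite mul1mx mulmxV // (SL3_unit _ b).
by rewrite /= invmx1 mxE eqxx oner_neq0.
Qed.

(** The last diagonal entry of the inverse is a minor of order 2 in the entries of [x]. *)
Lemma valuation_leading_minor1 :
  2 * v (leading_minor R 1)%:F <= v (leading_minor R 2)%:F.
Proof.
have [_ <-] := valuation_inv_entry ord_max ord_max.
apply: (@valuation_minor_ge entry _ ord_max) => [||x].
- exact: valuation_entry.
- by case: (valuation_inv_entry ord_max ord_max).
- rewrite [LHS]invmx_diag (_ : \matrix_(j, k) _ = SL3_mx x) //.
  by apply/matrixP => j k; rewrite mxE.
Qed.

(** Since [x] is the inverse of its inverse, its first entry is a minor of order 2 in the entries of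
    the inverse. *)
Lemma valuation_leading_minor2 :
  2 * v (leading_minor R 2)%:F <= v (leading_minor R 1)%:F.
Proof.
have [_ <-] := valuation_entry ord0 ord0.
apply: (@valuation_minor_ge inv_entry _ ord0) => [||x].
- exact: valuation_inv_entry.
- by case: (valuation_entry ord0 ord0).
- rewrite (_ : \matrix_(j, k) _ = SL3_inv x).
    by rewrite -invmx_diag /= invmxK.
  by apply/matrixP => j k; rewrite mxE.
Qed.

End Cone.

(** * Coweights in coordinates, and the valuation cone as the antidominant chamber *)

Lemma pairing_fundamental1 xi : pairing xi (fundamental_weight 1) = xi ord0 ord0.
Proof.
rewrite /pairing big_ord_recl big1 ?addr0 => [|j _]; first by rewrite mxE mulr1.
by rewrite mxE mulr0.
Qed.

Lemma pairing_fundamental2 xi :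
  pairing xi (fundamental_weight 2) = xi ord0 ord0 + xi ord0 (lift ord0 ord0).
Proof.
rewrite /pairing !big_ord_recl big_ord0 !mxE /=.
by rewrite !mulr1 mulr0 !addr0.
Qed.

Lemma pairing_root xi j k : pairing xi (root_weight j k) = xi 0 j - xi 0 k.
Proof.
have E (i : 'I_3) : \sum_l xi 0 l * (delta_mx 0 i 0 l : int)%:~R = xi 0 i :> rat.
  rewrite (bigD1 i) //= mxE !eqxx mulr1 big1 ?addr0 // => l /negPf li.
  by rewrite mxE li andbF mulr0.
rewrite -[in RHS](E j) -[in RHS](E k) -sumrB; apply: eq_bigr => l _.
by rewrite !mxE intrB mulrBr.
Qed.

Lemma coweightE (xi : 'rV[rat]_3) :
  coweight xi <-> xi ord0 ord_max = - (xi ord0 ord0 + xi ord0 (lift ord0 ord0)).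
Proof.
rewrite /coweight /= !big_ord_recl big_ord0 addr0.
rewrite (_ : lift ord0 (lift ord0 ord0) = ord_max); last exact: val_inj.
by rewrite addrA addrC; split => [/eqP|->]; rewrite ?addNr // addr_eq0 => /eqP.
Qed.

Lemma antidominantE (xi : 'rV[rat]_3) : antidominant_chamber xi <->
  coweight xi /\ xi ord0 ord0 <= xi ord0 (lift ord0 ord0) <= xi ord0 ord_max.
Proof.
split=> -[cw H]; split=> //.
  have H1 := H ord0 (lift ord0 ord0) isT; have H2 := H (lift ord0 ord0) ord_max isT.
  by move: H1 H2; rewrite !pairing_root !subr_le0 => -> ->.
case/andP: H => H1 H2 j k; rewrite pairing_root subr_le0.
have [m0 [m1 m2]] : [/\ xi 0 ord0 <= xi 0 (lift ord0 ord0),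
  xi 0 (lift ord0 ord0) <= xi 0 ord_max & xi 0 ord0 <= xi 0 ord_max].
  by split=> //; exact: le_trans H1 H2.
case: j => -[|[|[|//]]] j3; case: k => -[|[|[|//]]] k3 //= _.
- by move: m0; congr (xi 0 _ <= xi 0 _); apply: val_inj.
- by move: m2; congr (xi 0 _ <= xi 0 _); apply: val_inj.
- by move: m1; congr (xi 0 _ <= xi 0 _); apply: val_inj.
Qed.

Lemma common_denominator (I : finType) (x : I -> rat) :
  exists N (n : I -> int), (0 < N)%N /\ forall i, x i = (n i)%:~R / N%:R.
Proof.
exists (\prod_i absz (denq (x i)))%N.
exists (fun i => numq (x i) * (\prod_(k | k != i) absz (denq (x k)))%N%:Z).
have dpos i : (0 < absz (denq (x i)))%N by rewrite absz_gt0 denq_neq0.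
split=> [|i]; first by rewrite prodn_gt0.
rewrite [X in _ / X%:R](bigD1 i) //= natrM intrM.
set p := (\prod_(k | k != i) _)%N.
have p0 : (p%:R : rat) != 0 by rewrite pnatr_eq0 -lt0n prodn_gt0.
rewrite invfM mulrACA -pmulrn (mulfV p0) mulr1 natr_absz ger0_norm ?denq_ge0 //.
by rewrite divq_num_den.
Qed.

Lemma valuation_coneE (R : realType) : valuation_cone R = antidominant_chamber.
Proof.
apply/seteqP; split=> xi.
  move=> [cw [v [vi H]]]; apply/antidominantE; split=> //.
  have := H 1%N isT; have := H 2%N isT.
  rewrite pairing_fundamental1 pairing_fundamental2.
  (* For a traceless [xi] the two inequalities read [xi_0 <= xi_1] and [xi_1 <= xi_2]. *)
  have := valuation_leading_minor1 R v vi; have := valuation_leading_minor2 R v vi.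
  move=> H2 H1 E2 E1; rewrite -E1 -E2 in H1 H2; rewrite ((coweightE _).1 cw).
  by apply/andP; split; lra.
move=> /antidominantE [cw /andP[H1 H2]]; split=> //.
have [N [n [N0 nE]]] := common_denominator _ (fun j : 'I_3 => xi ord0 j).
have NQ : (N%:R : rat) != 0 by rewrite pnatr_eq0 -lt0n.
have le_n i j : (xi ord0 i <= xi ord0 j) = (n i <= n j).
  by rewrite !nE ler_pM2r ?ler_int // invr_gt0 ltr0n.
have sum_n : \sum_j n j = 0.
  apply/eqP; rewrite -(intr_eq0 rat) -(inj_eq (mulIf (invr_neq0 NQ))) mul0r.
  rewrite raddf_sum mulr_suml -[X in _ == X]cw; apply/eqP/eq_bigr => j _.
  by rewrite -nE.
rewrite !le_n in H1 H2.
have le0 j : n ord0 <= n j /\ n j <= n ord_max.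
  case: j => -[|[|[|//]]] j3.
  - rewrite (_ : Ordinal j3 = ord0) ?(le_trans H1 H2) //; exact: val_inj.
  - rewrite (_ : Ordinal j3 = lift ord0 ord0) //; exact: val_inj.
  - rewrite (_ : Ordinal j3 = ord_max) ?(le_trans H1 H2) //; exact: val_inj.
(* Here [n = N xi]. The least exponent [n_0] is the order of the first minor, and the greatest gives
   the second one order [- n_2 = n_0 + n_1]. *)
exists (order_valuation R n N); split; first exact: order_valuation_invariant.
have o1 : has_order R n (leading_minor R 1) (n ord0).
  have -> : (leading_minor R 1 : SL3 R -> _) = (fun x => x ord0 ord0).
    by apply/funext => x; exact: leading_minor1E.
  by apply: has_order_entry => // j; case: (le0 j).
have o2 : has_order R n (leading_minor R 2) (- n ord_max).
  have -> : (leading_minor R 2 : SL3 R -> _) = (fun x => invmx x ord_max ord_max).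
    by apply/funext => x; exact: leading_minor2E.
  by apply: has_order_invmx => // j; case: (le0 j).
have n1 : leading_minor R 1 != 0.
  apply: (CSL3_neq0_at _ _ (SL3_one R)).
  by rewrite leading_minor1E mxE eqxx oner_neq0.
have n2 : leading_minor R 2 != 0.
  apply: (CSL3_neq0_at _ _ (SL3_one R)).
  by rewrite leading_minor2E /= invmx1 mxE eqxx oner_neq0.
move=> i /orP[] /eqP ->; rewrite order_valuation_tofrac //.
  by rewrite pairing_fundamental1 (ordE _ _ sum_n _ _ o1) nE.
rewrite pairing_fundamental2 (ordE _ _ sum_n _ _ o2) intrN mulNr -nE.
by rewrite ((coweightE _).1 cw) opprK.
Qed.

(** * Spectrum of the Gram matrix of an invertible matrix *)

Section GramSpectrum.
Local Open Scope sesquilinear_scope.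
Variables (C : numClosedFieldType) (m : nat).
Implicit Types x : 'M[C]_m.

Lemma trmxC_mul k l p (A : 'M[C]_(k, l)) (B : 'M[C]_(l, p)) :
  (A *m B)^t* = B^t* *m A^t*.
Proof. by rewrite trmx_mul map_mxM. Qed.

Lemma mxtrace_gram x : \tr (x *m x^t*) = \sum_j \sum_k `|x j k| ^+ 2.
Proof.
apply: eq_bigr => j _; rewrite mxE; apply: eq_bigr => k _.
by rewrite !mxE normCK.
Qed.

(** With [P] unitary diagonalising [x x^*], the matrix [y = P x] satisfies [y y^* = diag d], so [d]
    is positive. The inverse of [x] is [z P] with [z = y^-1], and [z^* z] is diagonal with entries
    the inverses of those of [d]. *)
Lemma gram_spectrum x : x \in unitmx -> exists d : 'rV[C]_m,
  [/\ forall i, 0 < d 0 i, \prod_i d 0 i = `|\det x| ^+ 2,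
      \sum_j \sum_k `|x j k| ^+ 2 = \sum_i d 0 i &
      \sum_j \sum_k `|invmx x j k| ^+ 2 = \sum_i (d 0 i)^-1].
Proof.
move=> ux; pose A := x *m x^t*; pose P := spectralmx A; pose d := spectral_diag A.
have AJ : A^t* = A by rewrite trmxC_mul trmxCK.
have /orthomx_spectralP AE : A \is normalmx by apply/normalmxP; rewrite AJ.
have uP : P \is unitarymx := spectral_unitarymx A.
have uP' := unitarymx_unit uP.
pose y := P *m x; have uy : y \in unitmx by rewrite unitmx_mul uP' ux.
have yE : y *m y^t* = diag_mx d.
  rewrite trmxC_mul -(invmx_unitary uP) mulmxA -[P *m x *m _]mulmxA -/A AE.
  by rewrite !mulmxA mulmxV // mul1mx mulmxK.
have d_ge0 i : 0 <= d 0 i.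
  have := congr1 (fun B : 'M[C]_m => B i i) yE; rewrite mxE [in RHS]mxE eqxx mulr1n => <-.
  by apply: sumr_ge0 => k _; rewrite !mxE -normCK exprn_ge0.
have det_d : \prod_i d 0 i = `|\det x| ^+ 2.
  have -> : \prod_i d 0 i = \det A.
    by rewrite AE !det_mulmx mulrC mulrA -det_mulmx mulmxV // det1 mul1r det_diag.
  by rewrite det_mulmx det_map_mx det_tr normCK.
have d0 i : d 0 i != 0.
  have : \prod_i d 0 i != 0.
    by rewrite det_d expf_neq0 // normr_eq0 -unitfE -unitmxE.
  by rewrite prodf_seq_neq0 => /allP/(_ i); apply; rewrite mem_index_enum.
exists d; split=> //.
- by move=> i; rewrite lt_def d0 d_ge0.
- by rewrite -mxtrace_gram -/A AE mxtrace_mulC mulKVmx // mxtrace_diag.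
- pose z := invmx y; have zE : invmx x = z *m P.
    rewrite -[RHS]mulmx1 -(mulmxV ux) /z mulmxA -[z *m P *m x]mulmxA.
    by rewrite mulVmx // mul1mx.
  rewrite -mxtrace_gram zE trmxC_mul !mulmxA mulmxtVK // mxtrace_mulC.
  have -> : z^t* *m z = diag_mx (\row_i (d 0 i)^-1).
    have H : diag_mx d *m (z^t* *m z) = 1%:M.
      rewrite -yE !mulmxA -[y *m _ *m _]mulmxA -trmxC_mul mulVmx //.
      by rewrite trmx1 map_mx1 mulmx1 mulmxV.
    have H' : diag_mx (\row_i (d 0 i)^-1) *m diag_mx d = 1%:M.
      apply/matrixP => i j; rewrite mul_diag_mx !mxE.
      by case: eqP => [->|]; rewrite ?mulr0n ?mulr0 // mulVf.
    by rewrite -[LHS]mul1mx -H' -mulmxA H mulmx1.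
  by rewrite mxtrace_diag; apply: eq_bigr => i _; rewrite mxE.
Qed.

End GramSpectrum.

(** * Spherical functions in terms of the eigenvalues of the Gram matrix *)

Section Norms.
Variable R : realType.
Implicit Types (x : SL3 R).

Lemma sum_sets1 (T : finType) (F : {set T} -> R) :
  \sum_(J : {set T} | #|J| == 1%N) F J = \sum_j F [set j]%SET.
Proof.
rewrite -(big_imset (h := fun j : T => [set j]%SET) F (A := predT)) /=.
  apply: eq_bigl => J; apply/cards1P/imsetP => [[j ->]|[j _ ->]]; by exists j.
by move=> i j _ _ /set1_inj.
Qed.

(** In a set of three elements, pairs are the complements of singletons. *)
Lemma sum_sets2 (F : {set 'I_3} -> R) :
  \sum_(J : {set 'I_3} | #|J| == 2%N) F J = \sum_j F [set~ j]%SET.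
Proof.
rewrite -(sum_sets1 _ (fun J => F (~: J)%SET)).
rewrite (reindex_inj (inv_inj (@finset.setCK _))) /=; apply: eq_bigl => J.
have := cardsC J; rewrite card_ord; move: #|J| #|~: J|%SET => a b; lia.
Qed.

Definition sqnorm (A : 'M[complex R]_3) : R :=
  \sum_j \sum_k ComplexField.Normc.normc (A j k) ^+ 2.

Lemma phi1E x : phi 1 x = 3^-1 * sqnorm x.
Proof.
rewrite /phi sum_sets1 (_ : 'C(3, 1) = 3%N) //; congr (_ * _); apply: eq_bigr => j _.
by rewrite sum_sets1; apply: eq_bigr => k _; rewrite minor1E.
Qed.

Lemma phi2E x : phi 2 x = 3^-1 * sqnorm (invmx x).
Proof.
rewrite /phi sum_sets2 (_ : 'C(3, 2) = 3%N) //; congr (_ * _).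
(* The adjugate transposes indices, hence the exchange of sums. *)
rewrite /sqnorm [RHS]exchange_big /=.
apply: eq_bigr => j _; rewrite sum_sets2; apply: eq_bigr => k _.
rewrite minor2E invmx_SL3 !mxE /cofactor; congr (_ ^+ 2).
rewrite complex.ComplexField.Normc.normcM.
rewrite (_ : ComplexField.Normc.normc ((-1) ^+ (j + k)) = 1) ?mul1r //.
rewrite -signr_odd; case: (odd _); rewrite ?expr1 ?expr0 /=.
  by rewrite /ComplexField.Normc.normc /= oppr0 expr0n addr0 sqrrN expr1n sqrtr1.
by rewrite /ComplexField.Normc.normc /= expr0n addr0 expr1n sqrtr1.
Qed.

(** [a], [b], [c] are the eigenvalues of [x x^*], and [q] is also the sum of their inverses because
    their product is 1. *)
Definition gram_triple (p q : R) := exists a b c : R,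
  [/\ 0 < a, 0 < b, 0 < c & a * b * c = 1] /\
  p = a + b + c /\ q = a * b + b * c + c * a.

Lemma sqnormE (A : 'M[complex R]_3) :
  ((sqnorm A)%:C)%C = \sum_j \sum_k `|A j k| ^+ 2.
Proof.
rewrite /sqnorm rmorph_sum; apply: eq_bigr => j _; rewrite rmorph_sum.
by apply: eq_bigr => k _; rewrite rmorphXn.
Qed.

Lemma gram_triple_SL3 x : gram_triple (sqnorm x) (sqnorm (invmx x)).
Proof.
have [d [d_gt0 d1 dE dVE]] := gram_spectrum _ _ _ (SL3_unit _ x).
have [r rE] : exists r : 'I_3 -> R, forall i, d 0 i = ((r i)%:C)%C.
  exists (fun i => complex.Re (d 0 i)) => i.
  by rewrite RRe_real // gtr0_real.
have r_gt0 i : 0 < r i by rewrite -ltcR -rE.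
pose i1 : 'I_3 := lift ord0 ord0; pose i2 : 'I_3 := lift ord0 (lift ord0 ord0).
have r1 : r ord0 * r i1 * r i2 = 1.
  apply: (@complexI R).
  move: d1; rewrite !big_ord_recl big_ord0 !rE (eqP (SL3_det x)) normr1 expr1n.
  by rewrite mulr1 mulrA !rmorphM rmorph1.
exists (r ord0), (r i1), (r i2); split; first by split.
split; apply: (@complexI R); rewrite sqnormE ?dE ?dVE !big_ord_recl big_ord0 !rE addr0.
  by rewrite !rmorphD addrA.
have -> : r ord0 * r i1 + r i1 * r i2 + r i2 * r ord0 =
    (r ord0)^-1 + (r i1)^-1 + (r i2)^-1.
  have [n0 n1 n2] : [/\ r ord0 != 0, r i1 != 0 & r i2 != 0] by split; rewrite gt_eqF.
  apply: (mulfI n0); apply: (mulfI n1); apply: (mulfI n2).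
  by rewrite -[RHS]mul1r -r1; field; rewrite n0 n1 n2.
by rewrite !rmorphD !fmorphV addrA.
Qed.

Lemma gram_triple_onto p q : gram_triple p q ->
  exists x, sqnorm x = p /\ sqnorm (invmx x) = q.
Proof.
move=> [a [b [c [[a0 b0 c0 abc] [-> ->]]]]].
(* The witness is the diagonal matrix of the square roots of [a], [b], [c]. *)
pose s (i : 'I_3) := nth 0 [:: Num.sqrt a; Num.sqrt b; Num.sqrt c] i.
pose D (e : 'I_3 -> R) : 'M[complex R]_3 := diag_mx (\row_i ((e i)%:C)%C).
have detD e : \det (D e) = (((\prod_i e i) : R)%:C)%C.
  by rewrite det_diag rmorph_prod; apply: eq_bigr => i _; rewrite mxE.
have normD e : sqnorm (D e) = \sum_i e i ^+ 2.
  apply: eq_bigr => i _; rewrite (bigD1 i) //= big1 ?addr0 => [|j ji].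
    rewrite !mxE eqxx mulr1n /ComplexField.Normc.normc /=.
    by rewrite expr0n addr0 sqrtr_sqr real_normK ?num_real.
  by rewrite !mxE eq_sym (negPf ji) mulr0n ComplexField.Normc.normc0 expr0n.
have ps : \prod_i s i = 1.
  rewrite !big_ord_recl big_ord0 /s /= mulr1 mulrA.
  by rewrite -!sqrtrM ?mulr_ge0 ?ltW // abc sqrtr1.
have detDs : \det (D s) == 1 by rewrite detD ps.
exists (MkSL3 detDs); split.
  by rewrite normD !big_ord_recl big_ord0 /s /= !sqr_sqrtr ?ltW // addr0 addrA.
have s_gt0 i : s i != 0.
  by case: i => -[|[|[|//]]] i3; rewrite gt_eqF // /s /= sqrtr_gt0.
have -> : invmx (MkSL3 detDs) = D (fun i => (s i)^-1).
  have u := SL3_unit _ (MkSL3 detDs).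
  rewrite -[RHS](mulKmx u) (_ : _ *m D _ = 1%:M) ?mulmx1 //=.
  apply/matrixP => i j; rewrite mul_diag_mx !mxE.
  by case: eqP => [->|]; rewrite ?mulr0n ?mulr0 // -rmorphM mulfV.
rewrite normD !big_ord_recl big_ord0 /s /= !exprVn !sqr_sqrtr ?ltW // addr0.
have [n0 n1 n2] : [/\ a != 0, b != 0 & c != 0] by split; rewrite gt_eqF.
apply: (mulfI n0); apply: (mulfI n1); apply: (mulfI n2).
by rewrite -[LHS]mul1r -abc; field; rewrite n0 n1 n2.
Qed.

End Norms.

(** * Cubics [z^3 - p z^2 + q z - 1] with three positive roots *)

Section Cubic.
Variable R : realType.
Implicit Types a b c p q s u w z : R.

(** The discriminant of [z^3 - p z^2 + q z - 1]. *)
Definition disc p q : R :=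
  p ^+ 2 * q ^+ 2 - 4 * q ^+ 3 - 4 * p ^+ 3 + 18 * (p * q) - 27.

Lemma disc_triple a b c : a * b * c = 1 ->
  disc (a + b + c) (a * b + b * c + c * a) = ((a - b) * (b - c) * (c - a)) ^+ 2.
Proof.
move=> abc; rewrite /disc.
set p := a + b + c; set q := _ + _ + c * a.
(* Powers of [a * b * c = 1] make the expression homogeneous, which turns the claim into a
   polynomial identity. *)
transitivity (p ^+ 2 * q ^+ 2 - 4 * q ^+ 3 - 4 * p ^+ 3 * (a * b * c)
  + 18 * (p * q) * (a * b * c) - 27 * (a * b * c) ^+ 2).
  by rewrite abc; ring.
by rewrite /p /q; ring.
Qed.

Lemma triple_root a b c z : a * b * c = 1 -> z \in [:: a; b; c] ->
  z ^+ 3 - (a + b + c) * z ^+ 2 + (a * b + b * c + c * a) * z - 1 = 0.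
Proof. by move=> <-; rewrite !inE => /or3P[] /eqP ->; ring. Qed.

(** Replacing the roots by their inverses, which are [a b], [b c], [c a] up to order, exchanges [p]
    and [q]. *)
Lemma gram_triple_sym p q : gram_triple R p q -> gram_triple R q p.
Proof.
move=> [a [b [c [[a0 b0 c0 abc] [-> ->]]]]].
exists (a * b), (b * c), (c * a); split; first split; rewrite ?mulr_gt0 //.
  have -> : a * b * (b * c) * (c * a) = (a * b * c) ^+ 2 by ring.
  by rewrite abc expr1n.
split=> //; rewrite -[LHS]mulr1 -abc; ring.
Qed.

Lemma gram_triple_gt0 p q : gram_triple R p q -> 0 < p /\ 0 < q.
Proof.
by move=> [a [b [c [[a0 b0 c0 _] [-> ->]]]]]; rewrite !(addr_gt0, mulr_gt0).
Qed.

Lemma gram_triple_sqr p q : gram_triple R p q -> 3 * q <= p ^+ 2.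
Proof.
move=> [a [b [c [_ [-> ->]]]]]; rewrite -subr_ge0.
have -> : (a + b + c) ^+ 2 - 3 * (a * b + b * c + c * a) =
  ((a - b) ^+ 2 + (b - c) ^+ 2 + (c - a) ^+ 2) / 2 by field.
by rewrite divr_ge0 // !addr_ge0 ?sqr_ge0.
Qed.

(** If [p < 3], then [3 q <= p^2 < 3 p] gives [q < p < 3], while [3 q < 3 p <= q^2] gives
    [q > 3]. *)
Lemma gram_triple_ge3 p q : gram_triple R p q -> 3 <= p.
Proof.
move=> H; have [p0 q0] := gram_triple_gt0 _ _ H.
have H1 := gram_triple_sqr _ _ H; have H2 := gram_triple_sqr _ _ (gram_triple_sym _ _ H).
rewrite leNgt; apply/negP => p3.
have qp : 3 * q < 3 * p.
  by apply: le_lt_trans H1 _; rewrite expr2 ltr_pM2r.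
have : 3 * q < q ^+ 2 by apply: lt_le_trans H2.
rewrite expr2 ltr_pM2r //; lra.
Qed.

(** The other two roots are those of [z^2 - s z + 1/b]. The hypothesis makes them real, and their
    sum and product are positive. *)
Lemma gram_triple_of_root b s : 0 < b -> 0 < s -> 4 <= s ^+ 2 * b ->
  gram_triple R (b + s) (b^-1 + b * s).
Proof.
move=> b0 s0 H; pose d := s ^+ 2 - 4 / b; pose r := Num.sqrt d.
have bn : b != 0 by rewrite gt_eqF.
have d0 : 0 <= d.
  by rewrite /d subr_ge0 ler_pdivrMr.
have rE : r ^+ 2 = d by rewrite sqr_sqrtr.
have r0 : 0 <= r by exact: sqrtr_ge0.
pose c := (s + r) / 2; have c0 : 0 < c by rewrite divr_gt0 // ltr_wpDr.
pose a := (s - r) / 2.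
have ac : a * c = b^-1.
  have -> : a * c = (s ^+ 2 - r ^+ 2) / 4 by rewrite /a /c; field.
  by rewrite rE /d; field.
have a0 : 0 < a by rewrite -(pmulr_lgt0 _ c0) ac invr_gt0.
have sE : s = a + c by rewrite /a /c; field.
exists a, b, c; split; first by split=> //; rewrite mulrAC ac mulVf.
split; first by rewrite sE; ring.
by rewrite -ac sE; ring.
Qed.

Lemma gram_tripleP p q :
  gram_triple R p q <-> [/\ 0 < p, 0 < q & 0 <= disc p q].
Proof.
split=> [H|[p0 q0 d0]].
  have [p0 q0] := gram_triple_gt0 _ _ H; split=> //.
  by move: H => [a [b [c [[_ _ _ abc] [-> ->]]]]]; rewrite disc_triple // sqr_ge0.
pose f : {poly R} := 'X^3 - p *: 'X^2 + q *: 'X - 1.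
have fE z : f.[z] = z ^+ 3 - p * z ^+ 2 + q * z - 1.
  by rewrite /f !(hornerE, hornerXn).
(* The cubic is -1 at 0 and nonnegative at [p + 1], which gives a root [b]. *)
have [||b /andP[b0 _] /rootP] := @poly_ivt _ f 0 (p + 1); first lra.
  rewrite !fE !expr0n /=; apply/andP; split; first lra.
  have -> : (p + 1) ^+ 3 - p * (p + 1) ^+ 2 + q * (p + 1) - 1 =
    p ^+ 2 + 2 * p + q * (p + 1) by ring.
  by rewrite !addr_ge0 ?mulr_ge0 ?sqr_ge0 //; lra.
rewrite fE => fb; have bn : b != 0.
  by apply/eqP => b_0; move: fb; rewrite b_0 !expr0n /=; lra.
have {}b0 : 0 < b by rewrite lt_def bn.
pose s := p - b; have pE : p = b + s by rewrite /s; ring.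
have qE : q = b^-1 + b * s.
  apply: (mulfI bn); rewrite mulrDr mulfV // /s; move: fb; lra.
(* The discriminant of the cubic is that of the cofactor [z^2 - s z + 1/b] times the square of the
   value of this cofactor at [b]. *)
have dE : disc p q = (s ^+ 2 * b - 4) / b * (b ^+ 2 - s * b + b^-1) ^+ 2.
  by rewrite pE qE /disc; field.
have sb : 4 <= s ^+ 2 * b.
  (* If the cofactor vanishes at [b], then [disc p q = 0] carries no information; but [b] is then a
     double root, the third one is [b^-2], and the claim is explicit. *)
  have [g0|g0] := eqVneq (b ^+ 2 - s * b + b^-1) 0.
    have -> : s = b + b^-1 ^+ 2.
      apply: (mulfI bn); have -> : b * (b + b^-1 ^+ 2) = b ^+ 2 + b^-1 by field.
      by move: g0; lra.
    rewrite -subr_ge0 (_ : _ - _ = (b - b^-1 ^+ 2) ^+ 2 * b); last by field.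
    by rewrite mulr_ge0 ?sqr_ge0 // ltW.
  move: d0; rewrite dE pmulr_lge0 ?exprn_even_gt0 // ?g0 //.
  by rewrite pmulr_lge0 ?invr_gt0 // subr_ge0.
rewrite pE qE; apply: gram_triple_of_root => //.
(* If [s <= 0], positivity of [p] gives [- s < b] and that of [q] gives [- s b^2 < 1], so
   [s^2 b < 1], against [sb]. *)
rewrite ltNge; apply/negP => s0; have bs : - s < b by lra.
have h : b * (b * - s) < 1.
  have : 0 < b * q by rewrite mulr_gt0.
  by rewrite qE mulrDr mulfV //; lra.
have : s ^+ 2 * b <= b * (b * - s); last lra.
rewrite expr2 mulrC ler_pM2l // -mulrNN; apply: ler_wpM2r; lra.
Qed.

(** For given [p], the triple [(u, u, u^-2)] maximises [q]. For a larger [q], evaluating the cubic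
    at a root [z] forces [(z - u)^2 (u^2 z - 1) < 0], so all roots are below [u^-2] and [p u^2 < 3],
    whereas [p u^2 = 2 u^3 + 1 >= 3]. *)
Lemma gram_triple_hi p q u : gram_triple R p q -> 1 <= u ->
  p * u ^+ 2 = 2 * u ^+ 3 + 1 -> q * u <= u ^+ 3 + 2.
Proof.
move=> [a [b [c [[a0 b0 c0 abc] [pE qE]]]]] u1 pu; rewrite leNgt; apply/negP => lt.
have small z : 0 < z -> z \in [:: a; b; c] -> u ^+ 2 * z < 1.
  move=> z0 /(triple_root _ _ _ _ abc); rewrite -pE -qE => fz.
  rewrite ltNge; apply/negP => h.
  have : 0 <= (z - u) ^+ 2 * (u ^+ 2 * z - 1) by rewrite mulr_ge0 ?sqr_ge0 ?subr_ge0.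
  rewrite leNgt => /negP; apply.
  have -> : (z - u) ^+ 2 * (u ^+ 2 * z - 1) =
    u ^+ 2 * (z ^+ 3 - p * z ^+ 2 + q * z - 1) +
    (p * u ^+ 2 - (2 * u ^+ 3 + 1)) * z ^+ 2 - (q * u - (u ^+ 3 + 2)) * (u * z) by ring.
  by rewrite fz pu subrr mul0r mulr0 !add0r oppr_lt0 !mulr_gt0 // ?subr_gt0 //; lra.
have ha := small a a0; have hb := small b b0; have hc := small c c0.
rewrite !inE !eqxx /= ?orbT in ha hb hc.
have := ha isT; have := hb isT; have := hc isT => h1 h2 h3.
have u3 : 1 <= u ^+ 3 by rewrite exprn_ege1.
move: pu; rewrite pE mulrC !mulrDr; lra.
Qed.

(** Likewise [(w^2, 1/w, 1/w)] minimises [q]: for a smaller [q] all roots would exceed [w^2], so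
    [p > 3 w^2], whereas [p w = w^3 + 2 <= 3 w^3]. *)
Lemma gram_triple_lo p q w : gram_triple R p q -> 1 <= w ->
  p * w = w ^+ 3 + 2 -> 2 * w ^+ 3 + 1 <= q * w ^+ 2.
Proof.
move=> [a [b [c [[a0 b0 c0 abc] [pE qE]]]]] w1 pw; rewrite leNgt; apply/negP => lt.
have large z : 0 < z -> z \in [:: a; b; c] -> w ^+ 2 < z.
  move=> z0 /(triple_root _ _ _ _ abc); rewrite -pE -qE => fz.
  rewrite ltNge; apply/negP => h.
  have : 0 <= (w ^+ 2 - z) * (w * z - 1) ^+ 2 by rewrite mulr_ge0 ?sqr_ge0 ?subr_ge0.
  rewrite leNgt => /negP; apply.
  have -> : (w ^+ 2 - z) * (w * z - 1) ^+ 2 =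
    - (w ^+ 2 * (z ^+ 3 - p * z ^+ 2 + q * z - 1)) -
    (p * w - (w ^+ 3 + 2)) * (w * z ^+ 2) - ((2 * w ^+ 3 + 1) - q * w ^+ 2) * z by ring.
  by rewrite fz pw subrr mul0r mulr0 !oppr0 !add0r oppr_lt0 mulr_gt0 // subr_gt0.
have ha := large a a0; have hb := large b b0; have hc := large c c0.
rewrite !inE !eqxx /= ?orbT in ha hb hc.
have := ha isT; have := hb isT; have := hc isT => h1 h2 h3.
have w3 : 1 <= w ^+ 3 by rewrite exprn_ege1.
have : 3 * w ^+ 3 < p * w; last lra.
have -> : 3 * w ^+ 3 = (3 * w ^+ 2) * w by ring.
by rewrite ltr_pM2r ?pE; lra.
Qed.

Lemma hi_param p : 3 <= p -> exists2 u, 1 <= u & p * u ^+ 2 = 2 * u ^+ 3 + 1.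
Proof.
move=> p3; pose f : {poly R} := 2 *: 'X^3 - p *: 'X^2 + 1.
have fE z : f.[z] = 2 * z ^+ 3 - p * z ^+ 2 + 1 by rewrite /f !(hornerE, hornerXn).
have [||u /andP[u1 _] /rootP] := @poly_ivt _ f 1 p; first lra.
  rewrite !fE !expr1n; apply/andP; split; first lra.
  have -> : 2 * p ^+ 3 - p * p ^+ 2 + 1 = p ^+ 3 + 1 by ring.
  by rewrite addr_ge0 // exprn_ge0 //; lra.
by rewrite fE => fu; exists u => //; lra.
Qed.

Lemma lo_param p : 3 <= p -> exists2 w, 1 <= w & p * w = w ^+ 3 + 2.
Proof.
move=> p3; pose f : {poly R} := 'X^3 - p *: 'X + 2%:P.
have fE z : f.[z] = z ^+ 3 - p * z + 2 by rewrite /f !(hornerE, hornerXn).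
have [||u /andP[u1 _] /rootP] := @poly_ivt _ f 1 p; first lra.
  rewrite !fE !expr1n; apply/andP; split; first lra.
  have -> : p ^+ 3 - p * p + 2 = p ^+ 2 * (p - 1) + 2 by ring.
  by rewrite addr_ge0 // mulr_ge0 ?sqr_ge0 //; lra.
by rewrite fE => fu; exists u => //; lra.
Qed.

Lemma gram_triple_between p q u w : 1 <= u -> 1 <= w ->
  p * u ^+ 2 = 2 * u ^+ 3 + 1 -> p * w = w ^+ 3 + 2 ->
  q * u <= u ^+ 3 + 2 -> 2 * w ^+ 3 + 1 <= q * w ^+ 2 -> gram_triple R p q.
Proof.
move=> u1 w1 pu pw qu qw.
have u0 : 0 < u by lra. have w0 : 0 < w by lra.
have un : u != 0 by rewrite gt_eqF. have wn : w != 0 by rewrite gt_eqF.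
have pE : p = 2 * u + u^-1 ^+ 2.
  by apply: (mulIf (expf_neq0 2 un)); rewrite pu; field.
have pE' : p = w ^+ 2 + 2 / w by apply: (mulIf wn); rewrite pw; field.
(* The sign is changed because the cubic is nonnegative at [1/w] and nonpositive at [u]. *)
pose f : {poly R} := - ('X^3 - p *: 'X^2 + q *: 'X - 1).
have fE z : f.[z] = - (z ^+ 3 - p * z ^+ 2 + q * z - 1).
  by rewrite /f !(hornerE, hornerXn).
have wu : w^-1 <= u by apply: le_trans u1; rewrite invf_le1.
have [||b /andP[bw bu] /rootP] := @poly_ivt _ f w^-1 u; first exact: wu.
  rewrite !fE oppr_le0 oppr_ge0; apply/andP; split.
    have -> : w^-1 ^+ 3 - p * w^-1 ^+ 2 + q * w^-1 - 1 =
      (q * w ^+ 2 - (2 * w ^+ 3 + 1)) / w ^+ 3 by rewrite pE'; field.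
    by rewrite divr_ge0 ?subr_ge0 ?exprn_ge0 // ltW.
  have -> : u ^+ 3 - p * u ^+ 2 + q * u - 1 = q * u - (u ^+ 3 + 2) by rewrite pu; ring.
  by rewrite subr_le0.
rewrite fE => /eqP; rewrite oppr_eq0 => /eqP fb.
have b0 : 0 < b by apply: lt_le_trans bw; rewrite invr_gt0.
have bn : b != 0 by rewrite gt_eqF.
pose s := p - b; have psE : p = b + s by rewrite /s; ring.
have qE : q = b^-1 + b * s.
  by apply: (mulfI bn); rewrite mulrDr mulfV // /s; move: fb; lra.
have s0 : 0 < s.
  have : 0 < u^-1 ^+ 2 by rewrite exprn_gt0 // invr_gt0.
  by rewrite /s pE; lra.
rewrite psE qE; apply: gram_triple_of_root => //.
have [bE|bu'] := eqVneq b u.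
  rewrite /s pE bE -subr_ge0.
  have -> : (2 * u + u^-1 ^+ 2 - u) ^+ 2 * u - 4 = (u - u^-1 ^+ 2) ^+ 2 * u by field.
  by rewrite mulr_ge0 ?sqr_ge0 // ltW.
have {}bu : b < u by rewrite lt_def eq_sym bu'.
(* The cubic is nonpositive at [u]; dividing by [u - b > 0] shows that so is its quadratic
   cofactor. *)
have g : u ^+ 2 + b^-1 <= s * u.
  rewrite -subr_ge0 -(pmulr_lge0 _ (_ : 0 < u - b)) ?subr_gt0 //.
  have -> : (s * u - (u ^+ 2 + b^-1)) * (u - b) =
      u ^+ 3 + 2 - q * u - (2 * u ^+ 3 + 1 - p * u ^+ 2).
    rewrite psE qE; field; exact: bn.
  by rewrite pu subrr subr0 subr_ge0.
have g2 : (u ^+ 2 + b^-1) ^+ 2 <= (s * u) ^+ 2.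
  have h1 : 0 <= u ^+ 2 + b^-1 by rewrite addr_ge0 ?sqr_ge0 // invr_ge0 ltW.
  by rewrite ler_pXn2r // nnegrE // (le_trans h1 g).
(* The inequality between arithmetic and geometric means, which bounds the discriminant of the
   cofactor. *)
have g3 : 4 * (u ^+ 2 * b^-1) <= (u ^+ 2 + b^-1) ^+ 2.
  rewrite -subr_ge0 (_ : _ - _ = (u ^+ 2 - b^-1) ^+ 2) ?sqr_ge0 //; ring.
have : 4 * (u ^+ 2 * b^-1) <= (s * u) ^+ 2 by exact: le_trans g2.
rewrite exprMn mulrCA [_ * u ^+ 2]mulrC ler_pM2l ?exprn_gt0 //.
by rewrite ler_pdivrMr.
Qed.

Lemma gram_triple_double u : 0 < u ->
  gram_triple R (2 * u + u^-1 ^+ 2) (u ^+ 2 + 2 / u).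
Proof.
move=> u0; exists u, u, (u^-1 ^+ 2).
have un : u != 0 by rewrite gt_eqF.
by split; [split=> //; rewrite ?exprn_gt0 ?invr_gt0 //|split]; field.
Qed.

(** Two of the roots coincide, so the triple is [(a, a, a^-2)]. It lies on the first curve with
    [u = a] if [a >= 1], and otherwise on the second with [w = 1/a]. *)
Lemma disc0_param p q : gram_triple R p q -> disc p q = 0 ->
  (exists2 u, 1 <= u & p * u ^+ 2 = 2 * u ^+ 3 + 1 /\ q * u = u ^+ 3 + 2) \/
  (exists2 w, 1 <= w & p * w = w ^+ 3 + 2 /\ q * w ^+ 2 = 2 * w ^+ 3 + 1).
Proof.
have double a c : 0 < a -> a * a * c = 1 ->
    p = a + a + c -> q = a * a + a * c + c * a ->
  (exists2 u, 1 <= u & p * u ^+ 2 = 2 * u ^+ 3 + 1 /\ q * u = u ^+ 3 + 2) \/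
  (exists2 w, 1 <= w & p * w = w ^+ 3 + 2 /\ q * w ^+ 2 = 2 * w ^+ 3 + 1).
  move=> a0 aac -> ->; have an : a != 0 by rewrite gt_eqF.
  have -> : c = a^-1 ^+ 2.
    by apply: (mulfI an); apply: (mulfI an); rewrite mulrA aac; field.
  have [a1|a1] := leP 1 a; [left; exists a => // | right; exists a^-1].
  - by split; field.
  - by rewrite invf_ge1 // ltW.
  - by split; field.
move=> [a [b [c [[a0 b0 c0 abc] [pE qE]]]]].
rewrite pE qE disc_triple // => /eqP; rewrite sqrf_eq0 !mulf_eq0 !subr_eq0.
rewrite -pE -qE => /orP[/orP[]|] /eqP E.
- by apply: (double a c a0); rewrite -?abc ?pE ?qE -E; ring.
- by apply: (double b a b0); rewrite -?abc ?pE ?qE -E; ring.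
- by apply: (double c b c0); rewrite -?abc ?pE ?qE -E; ring.
Qed.

End Cubic.

(** * The image of the spherical logarithm and its boundary *)

Section Logarithmic.
Variable R : realType.
Implicit Types (t : R) (y : R * R).

Lemma logbP t z a : 0 < t < 1 -> 0 < z -> logb t z = a <-> z = expR (a * ln t).
Proof.
move=> t01 z0; have Ln : ln t != 0 by rewrite lt_eqF // ln_lt0.
split=> [<-|->]; first by rewrite /logb divfK // lnK.
by rewrite /logb expRK mulfK.
Qed.

Lemma range_sLogP t y : 0 < t < 1 -> range (sLog t) y <->
  gram_triple R (3 * expR (y.1 * ln t)) (3 * expR (y.2 * ln t)).
Proof.
move=> t01; split=> [[x _ <-]|/gram_triple_onto[x [xp xq]]].
  have H := gram_triple_SL3 _ x; have [p0 q0] := gram_triple_gt0 _ _ _ H.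
  have p1 : 0 < phi 1 x by rewrite phi1E mulr_gt0 // invr_gt0.
  have p2 : 0 < phi 2 x by rewrite phi2E mulr_gt0 // invr_gt0.
  rewrite -((logbP t (phi 1 x) _ t01 p1).1 erefl) -((logbP t (phi 2 x) _ t01 p2).1 erefl).
  by rewrite phi1E phi2E !mulrA mulfV ?mul1r // pnatr_eq0.
exists x => //; rewrite [RHS]surjective_pairing; congr (_, _); apply/(logbP _ _ _ t01).
- by rewrite phi1E xp mulr_gt0 ?invr_gt0 // mulr_gt0 ?expR_gt0.
- by rewrite phi1E xp mulrA mulVf ?mul1r.
- by rewrite phi2E xq mulr_gt0 ?invr_gt0 // mulr_gt0 ?expR_gt0.
- by rewrite phi2E xq mulrA mulVf ?mul1r.
Qed.

Let hi_gt0 (u : R) : 1 <= u -> 0 < (2 * u ^+ 3 + 1) / (3 * u ^+ 2).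
Proof.
move=> u1; have u0 : 0 < u by lra.
by rewrite divr_gt0 ?mulr_gt0 ?addr_gt0 ?mulr_gt0 ?exprn_gt0.
Qed.

Let lo_gt0 (u : R) : 1 <= u -> 0 < (2 + u ^+ 3) / (3 * u).
Proof.
move=> u1; have u0 : 0 < u by lra.
by rewrite divr_gt0 ?mulr_gt0 ?addr_gt0 ?exprn_gt0.
Qed.

Lemma eq_hi (p u : R) : 1 <= u ->
  (2 * u ^+ 3 + 1) / (3 * u ^+ 2) = p <-> 3 * p * u ^+ 2 = 2 * u ^+ 3 + 1.
Proof.
move=> u1; have un : u != 0 by rewrite gt_eqF //; lra.
split=> [<-|H]; first by field.
apply: (mulIf (_ : 3 * u ^+ 2 != 0)); first by rewrite mulf_neq0 // expf_neq0.
by rewrite divfK ?mulf_neq0 ?expf_neq0 // -H; ring.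
Qed.

Lemma eq_lo (p u : R) : 1 <= u ->
  (2 + u ^+ 3) / (3 * u) = p <-> 3 * p * u = u ^+ 3 + 2.
Proof.
move=> u1; have un : u != 0 by rewrite gt_eqF //; lra.
split=> [<-|H]; first by field.
apply: (mulIf (_ : 3 * u != 0)); first by rewrite mulf_neq0.
by rewrite divfK ?mulf_neq0 // addrC -H; ring.
Qed.

Lemma curve1P t y : 0 < t < 1 -> curve1 t y <-> exists2 u, 1 <= u &
  3 * expR (y.1 * ln t) * u ^+ 2 = 2 * u ^+ 3 + 1 /\
  3 * expR (y.2 * ln t) * u = u ^+ 3 + 2.
Proof.
move=> t01; split=> [[u /= u1 <-]|[u u1 [H1 H2]]].
  exists u => //=; split; [apply/eq_hi => // | apply/eq_lo => //]; apply/logbP => //.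
    exact: hi_gt0.
  exact: lo_gt0.
exists u => //; rewrite [RHS]surjective_pairing; congr (_, _); apply/logbP => //.
- exact: hi_gt0.
- exact/eq_hi.
- exact: lo_gt0.
- exact/eq_lo.
Qed.

Lemma curve2P t y : 0 < t < 1 -> curve2 t y <-> exists2 w, 1 <= w &
  3 * expR (y.1 * ln t) * w = w ^+ 3 + 2 /\
  3 * expR (y.2 * ln t) * w ^+ 2 = 2 * w ^+ 3 + 1.
Proof.
move=> t01; split=> [[u /= u1 <-]|[u u1 [H1 H2]]].
  exists u => //=; split; [apply/eq_lo => // | apply/eq_hi => //]; apply/logbP => //.
    exact: lo_gt0.
  exact: hi_gt0.
exists u => //; rewrite [RHS]surjective_pairing; congr (_, _); apply/logbP => //.
- exact: lo_gt0.
- exact/eq_lo.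
- exact: hi_gt0.
- exact/eq_hi.
Qed.

Lemma gram_triple_curve (p q u : R) : 1 <= u -> p * u ^+ 2 = 2 * u ^+ 3 + 1 ->
  q * u = u ^+ 3 + 2 -> gram_triple R p q.
Proof.
move=> u1 pu qu; have u0 : 0 < u by lra.
have un : u != 0 by rewrite gt_eqF.
have -> : p = 2 * u + u^-1 ^+ 2.
  by apply: (mulIf (expf_neq0 2 un)); rewrite pu; field.
have -> : q = u ^+ 2 + 2 / u by apply: (mulIf un); rewrite qu; field.
exact: gram_triple_double.
Qed.

Lemma ler_log t (a b : R) : 0 < t < 1 ->
  (expR (a * ln t) <= expR (b * ln t)) = (b <= a).
Proof.
by move=> t01; rewrite ler_expR ler_nM2r // ln_lt0.
Qed.

Lemma range_sLog_between t : 0 < t < 1 -> range (sLog t) =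
  [set y | exists b c, [/\ curve1 t (y.1, b), curve2 t (y.1, c) &
                 (b <= y.2 <= c) || (c <= y.2 <= b)]].
Proof.
move=> t01; have [t0 t1] := andP t01.
have L0 : ln t < 0 by rewrite ln_lt0.
have ex (z : R) : 0 < z -> exists a, z = 3 * expR (a * ln t).
  move=> z0; exists (ln (z / 3) / ln t).
  by rewrite divfK ?lt_eqF // lnK ?posrE ?divr_gt0 // mulrC divfK.
apply/seteqP; split=> y.
  move=> /(range_sLogP _ _ t01) H.
  have p3 := gram_triple_ge3 _ _ _ H.
  have [u u1 pu] := hi_param _ _ p3; have [w w1 pw] := lo_param _ _ p3.
  have u0 : 0 < u by lra. have w0 : 0 < w by lra.
  have [b bE] : exists b, u ^+ 2 + 2 / u = 3 * expR (b * ln t).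
    by apply: ex; rewrite addr_gt0 ?divr_gt0 ?exprn_gt0.
  have [c cE] : exists c, 2 * w + w^-1 ^+ 2 = 3 * expR (c * ln t).
    by apply: ex; rewrite addr_gt0 ?mulr_gt0 ?exprn_gt0 ?invr_gt0.
  have bE' : 3 * expR (b * ln t) * u = u ^+ 3 + 2.
    by rewrite -bE; field; rewrite gt_eqF.
  have cE' : 3 * expR (c * ln t) * w ^+ 2 = 2 * w ^+ 3 + 1.
    by rewrite -cE; field; rewrite gt_eqF.
  exists b, c; split.
  - by apply/curve1P => //; exists u.
  - by apply/curve2P => //; exists w.
  (* Since [ln t < 0], the upper bound on [q] becomes the lower bound [b] on [y.2], and the lower
     bound on [q] the upper bound [c]. *)
  have := gram_triple_hi _ _ _ _ H u1 pu; have := gram_triple_lo _ _ _ _ H w1 pw.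
  rewrite -bE' -cE' !ler_pM2r ?exprn_gt0 // !ler_pM2l // !ler_log //.
  by move=> -> ->.
move=> [b [c [/(curve1P _ _ t01)[/= u u1 [pu bu]] /(curve2P _ _ t01)[/= w w1 [pw cw]] bc]]].
have u0 : 0 < u by lra. have w0 : 0 < w by lra.
have Hb : gram_triple R (3 * expR (y.1 * ln t)) (3 * expR (b * ln t)).
  exact: gram_triple_curve u1 pu bu.
(* The point of the first curve comes from a triple itself, so the minimality of the second curve
   applies to it and rules out the other order. *)
have le_bc : b <= c.
  have := gram_triple_lo _ _ _ _ Hb w1 pw.
  by rewrite -cw ler_pM2r ?exprn_gt0 // ler_pM2l // ler_log.
have {bc}/andP[by2 cy2] : b <= y.2 <= c.
  by case/orP: bc => // /andP[h1 h2]; rewrite (le_trans le_bc h1) (le_trans h2 le_bc).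
apply/range_sLogP => //; apply: (gram_triple_between _ _ _ u w) => //.
  by rewrite -bu ler_pM2r // ler_pM2l // ler_log.
by rewrite -cw ler_pM2r ?exprn_gt0 // ler_pM2l // ler_log.
Qed.

Definition log_disc t y : R :=
  disc R (3 * expR (y.1 * ln t)) (3 * expR (y.2 * ln t)).

Lemma log_disc_continuous t : continuous (log_disc t).
Proof.
have E (f : R * R -> R) : continuous f ->
    continuous (fun y => 3 * expR (f y * ln t) : R).
  move=> cf y; apply: cvgM; first exact: cvg_cst.
  apply: (@continuous_comp _ _ _ (fun y => f y * ln t) expR).
    by apply: cvgM; [exact: cf | exact: cvg_cst].
  exact: continuous_expR.
have cp : continuous (fun y : R * R => 3 * expR (y.1 * ln t)).
  by apply: E => y; exact: cvg_fst.
have cq : continuous (fun y : R * R => 3 * expR (y.2 * ln t)).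
  by apply: E => y; exact: cvg_snd.
have X (f : R * R -> R) n : continuous f -> continuous (fun y => f y ^+ n).
  move=> cf y; apply: (@continuous_comp _ _ _ f (fun x => x ^+ n)); first exact: cf.
  exact: exprn_continuous.
move=> y; rewrite /log_disc /disc.
apply: cvgB; last exact: cvg_cst.
apply: cvgD; last first.
  apply: cvgM; first exact: cvg_cst.
  by apply: cvgM; [exact: cp | exact: cq].
apply: cvgB; last first.
  by apply: cvgM; [exact: cvg_cst | exact: (X _ 3%N cp)].
apply: cvgB; last first.
  by apply: cvgM; [exact: cvg_cst | exact: (X _ 3%N cq)].
by apply: cvgM; [exact: (X _ 2%N cp) | exact: (X _ 2%N cq)].
Qed.

(** Exponentials are positive, so nonnegativity of the discriminant is the only condition; this
    gives closedness and interior points by continuity. *)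
Lemma range_sLog_disc t : 0 < t < 1 ->
  range (sLog t) = log_disc t @^-1` [set z | 0 <= z].
Proof.
move=> t01; apply/seteqP; split=> y.
  by move=> /(range_sLogP _ _ t01)/gram_tripleP[].
by move=> H; apply/range_sLogP => //; apply/gram_tripleP; split; rewrite ?mulr_gt0 ?expR_gt0.
Qed.

Lemma closed_range_sLog t : 0 < t < 1 -> closed (range (sLog t)).
Proof.
move=> t01; rewrite range_sLog_disc //; apply: closed_comp; last exact: closed_ge.
by move=> y _; exact: log_disc_continuous.
Qed.

Lemma not_interior y (A : set (R * R)) :
  (forall d, 0 < d -> ~ A (y.1, y.2 + d)) \/ (forall d, 0 < d -> ~ A (y.1, y.2 - d)) ->
  ~ A° y.
Proof.
move=> H /nbhs_ballP[e /= e0 sA].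
have e2 : 0 < e / 2 by rewrite divr_gt0.
case: H => /(_ _ e2); apply; apply: sA; split; rewrite /= /ball /= ?subrr ?normr0 //.
  by rewrite opprD addrA subrr sub0r normrN gtr0_norm //; lra.
by rewrite opprB addrC subrK gtr0_norm //; lra.
Qed.

(** Where the discriminant is positive the point is interior; where it vanishes there is a double
    root, hence a point of a curve. Conversely the first curve is the lower edge and the second the
    upper edge, and a vertical move outwards leaves the image. *)
Lemma boundary_range_sLog t : 0 < t < 1 ->
  closure (range (sLog t)) `\` (range (sLog t))° = curve1 t `|` curve2 t.
Proof.
move=> t01; have /closure_id <- := closed_range_sLog _ t01.
apply/seteqP; split=> y.
  move=> [yA nyA]; have H := (range_sLogP _ _ t01).1 yA.
  have d0 : log_disc t y = 0.
    apply: contrapT => /eqP dn; apply: nyA.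
    have dpos : 0 < log_disc t y.
      by rewrite lt_def dn; move: yA; rewrite range_sLog_disc.
    have oU : open (log_disc t @^-1` [set z | 0 < z]).
      apply: open_comp; last exact: open_gt.
      by move=> z _; exact: log_disc_continuous.
    apply: (@filterS _ (nbhs y) _ (log_disc t @^-1` [set z | 0 < z])).
      by rewrite range_sLog_disc // => z; exact: ltW.
    exact: open_nbhs_nbhs.
  have [K|K] := disc0_param _ _ _ H d0; [left; exact/curve1P | right; exact/curve2P].
have L0 : ln t < 0 by rewrite ln_lt0.
have lt_shift (a d : R) : 0 < d -> expR (a * ln t) < expR ((a - d) * ln t).
  by move=> d0; rewrite ltr_expR ltr_nM2r // ltrBlDr ltrDl.
have lt_shift' (a d : R) : 0 < d -> expR ((a + d) * ln t) < expR (a * ln t).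
  by move=> d0; rewrite ltr_expR ltr_nM2r // ltrDl.
case=> [/(curve1P _ _ t01)[u u1 [pu qu]]|/(curve2P _ _ t01)[u u1 [pu qu]]].
  have u0 : 0 < u by lra.
  split; first by apply/range_sLogP => //; exact: gram_triple_curve u1 pu qu.
  apply: not_interior; right => d d0 /(range_sLogP _ _ t01)/= H.
  have := gram_triple_hi _ _ _ _ H u1 pu; rewrite -qu ler_pM2r // ler_pM2l //.
  by rewrite leNgt lt_shift.
have u0 : 0 < u by lra.
split.
  by apply/range_sLogP => //; apply: gram_triple_sym; exact: gram_triple_curve u1 qu pu.
apply: not_interior; left => d d0 /(range_sLogP _ _ t01)/= H.
  have := gram_triple_lo _ _ _ _ H u1 pu; rewrite -qu ler_pM2r ?exprn_gt0 // ler_pM2l //.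
  by rewrite leNgt lt_shift'.
Qed.

End Logarithmic.

(** * Kuratowski limit of the images, and the real valuation cone *)

Section Limit.
Variable R : realType.
Implicit Types (t : R) (y : R * R).

Definition real_chamber : set (R * R) :=
  [set a | 2 * a.1 - a.2 <= 0 /\ 2 * a.2 - a.1 <= 0].

Lemma closed_real_chamber : closed real_chamber.
Proof.
have -> : real_chamber = (fun y : R * R => 2 * y.1 - y.2) @^-1` [set z | z <= 0] `&`
    (fun y : R * R => 2 * y.2 - y.1) @^-1` [set z | z <= 0] by [].
apply: closedI; (apply: closed_comp; last exact: closed_le) => y _.
- apply: cvgB; last exact: cvg_snd.
  by apply: cvgM; [exact: cvg_cst | exact: cvg_fst].
- apply: cvgB; last exact: cvg_fst.
  by apply: cvgM; [exact: cvg_cst | exact: cvg_snd].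
Qed.

(** In [3 q <= p^2] and [3 p <= q^2] the factors 9 coming from the normalisation of [phi] cancel, so
    the inclusion is exact for each [t]. *)
Lemma range_sLog_sub t : 0 < t < 1 -> range (sLog t) `<=` real_chamber.
Proof.
move=> t01 y /(range_sLogP _ _ _ t01) H.
have L0 : ln t < 0 by rewrite ln_lt0.
have sub (a b : R) : 3 * (3 * expR (b * ln t)) <= (3 * expR (a * ln t)) ^+ 2 ->
    2 * a - b <= 0.
  rewrite exprMn mulrA -expr2 ler_pM2l // -expRM_natl ler_expR mulrA ler_nM2r //.
  by rewrite subr_le0.
by split; apply: sub; apply: gram_triple_sqr => //; exact: gram_triple_sym.
Qed.

(** The factor between 1 and 3 separating [p] from [expR (a * L)], once [p] is divided by 3, changes
    the quotient by at most [ln 3 / |L|]. *)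
Lemma logb_near (L a p e : R) : 0 < e -> L < - (ln 3 / e) ->
  expR (a * L) <= p -> p <= 3 * expR (a * L) -> `|a - ln (p / 3) / L| < e.
Proof.
move=> e0 Le ap pa; have l3 : 0 < ln 3 :> R by rewrite ln_gt0 //; lra.
have q0 : 0 < ln 3 / e by rewrite divr_gt0.
have L0 : L < 0 by lra.
have p0 : 0 < p by apply: lt_le_trans ap; exact: expR_gt0.
have h1 : a * L <= ln p by rewrite -[a * L]expRK ler_ln // posrE expR_gt0.
have h2 : ln p <= ln 3 + a * L.
  by rewrite -[a * L in X in _ <= X]expRK -lnM ?posrE ?expR_gt0 //
    ler_ln // posrE mulr_gt0 ?expR_gt0.
have lE : ln (p / 3) = ln p - ln 3 by rewrite ln_div ?posrE.
have -> : a - ln (p / 3) / L = (a * L - ln p + ln 3) / L.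
  by rewrite lE; field; rewrite lt_eqF.
rewrite normrM normfV (ltr0_norm L0) ltr_pdivrMr ?oppr_gt0 //.
rewrite ger0_norm; last lra.
apply: le_lt_trans (_ : ln 3 < _); first lra.
have : ln 3 / e < - L by lra.
by rewrite ltr_pdivrMr // mulrC.
Qed.

Lemma range_sLog_approx y (e : R) : real_chamber y -> 0 < e ->
  exists2 d : R, 0 < d & forall t, 0 < t < d -> exists2 z, range (sLog t) z &
    ball y e z.
Proof.
(* With this bound, [t < d] means [ln 3 / |ln t| < e]. *)
move=> [/= h1 h2] e0; exists (expR (- (ln 3 / e))); first exact: expR_gt0.
have l3 : 0 < ln 3 / e by rewrite divr_gt0 // ln_gt0 //; lra.
move=> t /andP[t0 td]; have Lt : ln t < - (ln 3 / e).
  by rewrite -[X in _ < X]expRK ltr_ln // posrE expR_gt0.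
have L0 : ln t < 0 by lra.
have t01 : 0 < t < 1 by rewrite t0 (lt_trans td) // expR_lt1 oppr_lt0.
(* The eigenvalues are [t] to the powers [y.1 <= y.2 - y.1 <= - y.2], ordered so by the chamber. As
   [t < 1], [a] is the largest of the three and [a * b] the largest of the pairwise products, so
   each sum is at most three times this term. *)
pose a := expR (y.1 * ln t); pose b := expR ((y.2 - y.1) * ln t).
pose c := expR (- y.2 * ln t).
have abc : a * b * c = 1.
  by rewrite /a /b /c -!expRD -expR0; congr expR; ring.
have [a0 b0 c0] : [/\ 0 < a, 0 < b & 0 < c] by split; exact: expR_gt0.
have ab : a * b = expR (y.2 * ln t) by rewrite /a /b -expRD; congr expR; ring.
have bc : b * c = expR (- y.1 * ln t) by rewrite /c /b -expRD; congr expR; ring.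
have ca : c * a = expR ((y.1 - y.2) * ln t) by rewrite /c /a -expRD; congr expR; ring.
have le_exp (u v : R) : v <= u -> expR (u * ln t) <= expR (v * ln t).
  by move=> uv; rewrite ler_expR ler_nM2r.
exists (logb t ((a + b + c) / 3), logb t ((a * b + b * c + c * a) / 3)).
  apply/(range_sLogP _ _ _ t01); rewrite /= /logb !divfK ?lt_eqF //.
  rewrite !lnK ?posrE ?divr_gt0 ?addr_gt0 ?mulr_gt0 //.
  exists a, b, c; split; first by split.
  by split; rewrite mulrC divfK.
split; rewrite /= /ball /=; apply: logb_near => //.
- by rewrite -/a; lra.
- have : b <= a by apply: le_exp; lra.
  have : c <= a by apply: le_exp; lra.
  by rewrite -/a; lra.
- rewrite -ab; have := mulr_gt0 b0 c0; have := mulr_gt0 c0 a0; lra.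
- have : b * c <= a * b by rewrite bc ab; apply: le_exp; lra.
  have : c * a <= a * b by rewrite ca ab; apply: le_exp; lra.
  by rewrite -ab; lra.
Qed.

Lemma range_sLog_kuratowski :
  kuratowski_cvg (fun t => range (sLog t)) real_chamber.
Proof.
split=> y Cy.
  exists (~` real_chamber).
    by apply: open_nbhs_nbhs; split => //; apply: closed_openC; exact: closed_real_chamber.
  exists 1 => // t t01; rewrite -subset0 => z [rz nz]; apply: nz.
  exact: range_sLog_sub rz.
move=> U /nbhs_ballP[e /= e0 sU].
have [d d0 H] := range_sLog_approx y e Cy e0.
by exists d => // t /H[z rz bz]; exists z; split => //; exact: sU.
Qed.

Lemma coweight_coords_chamber xi : antidominant_chamber xi ->
  real_chamber (coweight_coords R xi).
Proof.
move=> /antidominantE[cw /andP[h1 h2]].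
rewrite /coweight_coords pairing_fundamental1 pairing_fundamental2.
rewrite ((coweightE _).1 cw) in h2.
have e (q : rat) : q <= 0 -> ratr q <= 0 :> R by rewrite lerq0.
have E1 := e (2 * xi ord0 ord0 - (xi ord0 ord0 + xi ord0 (lift ord0 ord0))).
have E2 := e (2 * (xi ord0 ord0 + xi ord0 (lift ord0 ord0)) - xi ord0 ord0).
split=> /=.
  by have := E1; rewrite rmorphB rmorphM /= rmorph_nat; apply; lra.
by have := E2; rewrite rmorphB rmorphM /= rmorph_nat; apply; lra.
Qed.

Lemma real_valuation_coneE : real_valuation_cone R = real_chamber.
Proof.
rewrite /real_valuation_cone valuation_coneE; apply/seteqP; split.
  have /closure_id -> := closed_real_chamber.
  by apply: closureS => _ [xi Hxi <-]; exact: coweight_coords_chamber.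
move=> y [h1 h2] U /nbhs_ballP[e /= e0 sU].
(* The approximation is made on [2 a_1 - a_2] and [2 a_2 - a_1], for which the chamber is a
   quadrant; rationals taken from below stay in it. *)
have ap (x : R) : x <= 0 -> exists2 q : rat, q <= 0 & `|x - ratr q| < e.
  move=> x0; have xe : x - e < x by lra.
  have [q] := rat_in_itvoo xe.
  rewrite in_itv /= => /andP[q1 q2]; exists q; last by rewrite ltr_norml; apply/andP; split; lra.
  by rewrite -(lerq0 R); lra.
have [p p0 pe] := ap _ h1; have [q q0 qe] := ap _ h2.
(* The inverse of the Cartan matrix recovers the coordinates; the coefficients 2/3 and 1/3 keep the
   error below [e]. *)
pose a1 := (2 * p + q) / 3; pose a2 := (p + 2 * q) / 3.
pose xi : 'rV[rat]_3 := \row_j nth 0 [:: a1; a2 - a1; - a2] j.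
have x0 : xi ord0 ord0 = a1 by rewrite mxE.
have x1 : xi ord0 (lift ord0 ord0) = a2 - a1 by rewrite mxE.
have x2 : xi ord0 ord_max = - a2 by rewrite mxE.
exists (coweight_coords R xi); split.
  exists xi => //; apply/antidominantE; split.
    by apply/coweightE; rewrite x0 x1 x2; lra.
  by rewrite x0 x1 x2 /a1 /a2; apply/andP; split; lra.
apply: sU; rewrite /coweight_coords pairing_fundamental1 pairing_fundamental2 x0 x1.
have -> : a1 + (a2 - a1) = a2 by ring.
have r1 : ratr a1 = (2 * ratr p + ratr q) / 3 :> R.
  by rewrite /a1 fmorph_div /= rmorphD rmorphM /= !rmorph_nat.
have r2 : ratr a2 = (ratr p + 2 * ratr q) / 3 :> R.
  by rewrite /a2 fmorph_div /= rmorphD rmorphM /= !rmorph_nat.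
move: pe qe; rewrite !ltr_norml => /andP[p1 p2] /andP[q1 q2].
by split; rewrite /= /ball /= ?r1 ?r2 ltr_norml; apply/andP; split; lra.
Qed.

End Limit.

Theorem mainTheorem8 (R : realType) :
  [/\ forall t : R, 0 < t < 1 ->
        region_bounded_by (range (sLog t)) (curve1 t) (curve2 t),
      kuratowski_cvg (fun t : R => range (sLog t)) (real_valuation_cone R),
      valuation_cone R = antidominant_chamber &
      real_valuation_cone R =
        [set a : R * R | 2 * a.1 - a.2 <= 0 /\ 2 * a.2 - a.1 <= 0]].
Proof.
split.
- by move=> t t01; split; [exact: range_sLog_between | exact: boundary_range_sLog].
- by rewrite real_valuation_coneE; exact: range_sLog_kuratowski.
- exact: valuation_coneE.
- exact: real_valuation_coneE.
Qed.
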